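(* Let $\Bbbk$ be an algebraically closed field of characteristic $0$, let $\Omega\in\Bbbk[x_1,x_2,x_3]$ be a nonzero homogeneous polynomial of degree $3$, and let $P=\Bbbk[x_1,x_2,x_3]$ be the Poisson algebra with bracket determined by \[ \{x_1,x_2\}=\frac{\partial\Omega}{\partial x_3},\quad \{x_2,x_3\}=\frac{\partial\Omega}{\partial x_1},\quad \{x_3,x_1\}=\frac{\partial\Omega}{\partial x_2} \] (a unimodular quadratic Poisson algebra). Let $G\subseteq \mathrm{PAut}_{\mathrm{gr}}(P)$ be a finite subgroup. Then the invariant subalgebra $P^G$ is isomorphic to $P$ as Poisson algebras if and only if $G$ is trivial.
   Context: $P$ carries the standard grading ($\deg x_i=1$). A graded Poisson automorphism of $P$ is a bijective algebra homomorphism $\phi:P\to P$ preserving the bracket and with $\phi(P_i)=P_i$ for all $i$; these form the group $\mathrm{PAut}_{\mathrm{gr}}(P)$. For $G\subseteq \mathrm{PAut}_{\mathrm{gr}}(P)$, $P^G=\{a\in P:\phi(a)=a \text{ for all }\phi\in G\}$, a Poisson subalgebra of $P$ with the restricted bracket. A Poisson isomorphism is an algebra isomorphism that is also a Lie algebra isomorphism. *)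

(* Defs.v *)
From HB Require Import structures.
From mathcomp Require Import all_boot all_order all_algebra.
From mathcomp Require Import mpoly.
From Stdlib Require List.
Set Implicit Arguments. Unset Strict Implicit. Unset Printing Implicit Defensive.
Import GRing.Theory.
Local Open Scope ring_scope.

(* P = k[x1,x2,x3]; variables are indexed by 'I_3 : x1 = 'X_0, x2 = 'X_1, x3 = 'X_2. *)
Notation poly3 K := {mpoly K[3]}.

(* p is homogeneous of degree d: every monomial in its support has total degree d
   (the zero polynomial is homogeneous of every degree).  P_d = {p | homog_deg d p}. *)
Definition homog_deg (K : fieldType) (d : nat) (p : poly3 K) : Prop :=
  forall m, m \in msupp p -> mdeg m = d.

Definition d1 (K : fieldType) (p : poly3 K) := mderiv (0 : 'I_3) p.
Definition d2 (K : fieldType) (p : poly3 K) := mderiv (1 : 'I_3) p.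
Definition d3 (K : fieldType) (p : poly3 K) := mderiv (2 : 'I_3) p.

(* The Jacobian Poisson bracket determined by Omega:
   {f,g} = det (grad f, grad g, grad Omega).  It is the unique biderivation with
   {x1,x2} = d3 Omega, {x2,x3} = d1 Omega, {x3,x1} = d2 Omega. *)
Definition pbr (K : fieldType) (Om f g : poly3 K) : poly3 K :=
    d1 f * (d2 g * d3 Om - d3 g * d2 Om)
  - d2 f * (d1 g * d3 Om - d3 g * d1 Om)
  + d3 f * (d1 g * d2 Om - d2 g * d1 Om).

Definition is_alg_hom (K : fieldType) (phi : poly3 K -> poly3 K) : Prop :=
  [/\ forall a b, phi (a + b) = phi a + phi b,
      forall (c : K) a, phi (c *: a) = c *: phi a,
      forall a b, phi (a * b) = phi a * phi b &
      phi 1 = 1].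

Definition is_graded_poisson_aut (K : fieldType) (Om : poly3 K)
    (phi : poly3 K -> poly3 K) : Prop :=
  [/\ bijective phi,
      is_alg_hom phi,
      forall a b, phi (pbr Om a b) = pbr Om (phi a) (phi b) &
      forall i : nat,
        (forall p, homog_deg i p -> homog_deg i (phi p)) /\
        (forall q, homog_deg i q -> exists2 p, homog_deg i p & phi p = q)].

Definition finite_subgroup_PAut (K : fieldType) (Om : poly3 K)
    (G : (poly3 K -> poly3 K) -> Prop) : Prop :=
  [/\ forall g, G g -> is_graded_poisson_aut Om g,
      G id,
      forall g h, G g -> G h -> G (g \o h),
      (forall g, G g -> exists2 h, G h & cancel g h /\ cancel h g) &
      exists s : seq (poly3 K -> poly3 K), forall g, G g -> Stdlib.Lists.List.In g s].

Definition invariants (K : fieldType) (G : (poly3 K -> poly3 K) -> Prop)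
    (a : poly3 K) : Prop := forall g, G g -> g a = a.

Definition poisson_iso_to_invariants (K : fieldType) (Om : poly3 K)
    (G : (poly3 K -> poly3 K) -> Prop) : Prop :=
  exists psi : poly3 K -> poly3 K,
    [/\ is_alg_hom psi,
        injective psi,
        (forall a, invariants G (psi a)),
        (forall b, invariants G b -> exists a, psi a = b) &
        forall a b, psi (pbr Om a b) = pbr Om (psi a) (psi b)].

Definition trivial_group (K : fieldType) (G : (poly3 K -> poly3 K) -> Prop) : Prop :=
  forall g, G g -> forall a, g a = a.

(* Main.v *)
Require Import Defs.
From HB Require Import structures.
From mathcomp Require Import all_boot all_order all_algebra.
From mathcomp Require Import mpoly ring zify.
From Stdlib Require Import Classical.
Set Implicit Arguments. Unset Strict Implicit. Unset Printing Implicit Defensive.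
Import Order.Theory GRing.Theory.
Local Open Scope ring_scope.

(* Write [t] for the images of the three coordinates under an isomorphism onto
   the invariant ring [P^G] and [J] for the Jacobian determinant of [t].

   Cramer's identity turns compatibility with the brackets into
   [grad (Om(t)) = J * grad Om].  The invariant ring is graded, so [J] is a
   constant multiple of the Jacobian of homogeneous invariants and is homogeneous
   of some degree [N].  If [N = 0], three independent linear forms are invariant
   and [G] is trivial.

   If [N > 0], Euler's formula gives [(N + 3) (Om(t) - c) = 3 J Om] for a constant
   [c], and then [J ^ 3 = e Om ^ N].  If [Om] is not singular at [t(0)], then
   [Om(t) - c] can replace one of the homogeneous generators, which contradicts the
   degree of [J].  Otherwise [c = 0].  The discriminants of the orbit polynomials of
   three generic linear forms show that [J], hence [Om], is a product of linear
   forms.  The normal forms [xyz], [xy(ax + by)], [x^2 y] and [x^3] of [Om] are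
   then excluded using that [P] is finite over [P^G]. *)

(** * Derivatives, substitution and homogeneity in [n] variables *)

Section MPolyGeneral.
Variables (n : nat) (K : fieldType).
Implicit Types (p q : {mpoly K[n]}) (m : 'X_{1..n}).

(** The obstacle is that an isomorphism onto [P^G] need not be graded: the entries of [t] may be
    inhomogeneous with nonzero constant terms. Homogeneous invariants are therefore written [a(t)],
    and three of them are good substitutes for generators when the Jacobian of the polynomials [a]
    is nonzero at the point [t(0)]. Then [jac(a)(t)] has a nonzero constant term, and such a factor
    of a nonzero homogeneous polynomial is constant; this is how [J] inherits homogeneity.

    The exponents in [J ^ 3 = e Om ^ N] come from [N dlog Om = 3 dlog J], where [3 = deg Om]. Once
    [c = 0], [Om(t)] is proportional to [J Om], so every factor of [Om(t)] is built from the linear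
    factors of [Om]. In each normal form this determines the entries of [t] dividing [Om(t)] up to
    scalars and exponents.

    Finiteness of [P] over [P^G] is used in two concrete forms: only the origin has image [t(0)],
    and each [u] is a root of a monic polynomial over the image. The linear forms whose product [J]
    divides are the [u - g u] for [g] nontrivial. *)

Lemma mpoly_ring_ind (Q : {mpoly K[n]} -> Prop) :
  (forall c, Q c%:MP) -> (forall i, Q 'X_i) ->
  (forall p q, Q p -> Q q -> Q (p + q)) ->
  (forall p q, Q p -> Q q -> Q (p * q)) -> forall p, Q p.
Proof.
move=> QC QX QD QM; elim/mpolyind => [|c m p _ _ Qp]; first by rewrite -mpolyC0.
apply: (QD) Qp; rewrite -mul_mpolyC; apply: (QM) => //.
rewrite mpolyXE_id; elim/big_rec: _ => [|i q _ Qq]; first by rewrite -mpolyC1.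
by apply: (QM) Qq; elim: (m i) => [|k IH]; rewrite ?expr0 -?mpolyC1 // exprS; apply: (QM).
Qed.

Lemma mderivXU i j : mderiv i 'X_j = (i == j)%:R :> {mpoly K[n]}.
Proof.
rewrite mderivX mnm1E eq_sym; case: eqP => [->|_]; last by rewrite scale0r.
by rewrite scale1r -[X in (X - _)%MM]add0m addmK mpolyX0.
Qed.

Lemma mderiv_comp k (t : n.-tuple {mpoly K[k]}) j p :
  mderiv j (p \mPo t) = \sum_i (mderiv i p \mPo t) * mderiv j (tnth t i).
Proof.
elim/mpoly_ring_ind: p => [c|l|p q IHp IHq|p q IHp IHq].
- rewrite comp_mpolyC mderivC big1 // => i _.
  by rewrite mderivC comp_mpoly0 mul0r.
- rewrite comp_mpolyXU (bigD1 l) //= big1 => [|i neq_il].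
    by rewrite mderivXU eqxx comp_mpoly1 mul1r addr0 -tnth_nth.
  by rewrite mderivXU (negPf neq_il) comp_mpoly0 mul0r.
- rewrite comp_mpolyD mderivD IHp IHq -big_split /=; apply: eq_bigr => i _.
  by rewrite mderivD comp_mpolyD mulrDl.
rewrite rmorphM /= mderivM IHp IHq mulr_suml mulr_sumr -big_split /=.
apply: eq_bigr => i _; rewrite mderivM comp_mpolyD !rmorphM /=.
by rewrite mulrDl mulrAC !mulrA.
Qed.

Lemma comp_mpolyA k l (t : n.-tuple {mpoly K[k]}) (s : k.-tuple {mpoly K[l]}) p :
  (p \mPo t) \mPo s = p \mPo [tuple tnth t i \mPo s | i < n].
Proof.
elim/mpoly_ring_ind: p => [c|i|p q IHp IHq|p q IHp IHq].
- by rewrite !comp_mpolyC.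
- by rewrite !comp_mpolyXU -!tnth_nth tnth_mktuple.
- by rewrite !comp_mpolyD IHp IHq.
by rewrite !rmorphM /= IHp IHq.
Qed.

Lemma mcoeff_Xderiv i p m : ('X_i * mderiv i p)@_m = (m i)%:R * p@_m.
Proof.
have XdX m' : 'X_i * mderiv i 'X_[m'] = (m' i)%:R *: 'X_[m'] :> {mpoly K[n]}.
  rewrite mderivX -scalerAr; have [->|nz] := eqVneq (m' i) 0%N.
    by rewrite !scale0r.
  by rewrite -mpolyXD addmC submK // lep1mP.
elim/mpolyind: p => [|c m' p _ _ IH].
  by rewrite mderiv0 mulr0 mcoeff0 mulr0.
rewrite mderivD mulrDr mcoeffD IH mcoeffD mulrDr; congr (_ + _).
rewrite mderivZ -scalerAr XdX !mcoeffZ !mcoeffX.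
by case: eqP => [->|_]; rewrite ?mulr1 ?mulr0 // mulrC.
Qed.

Lemma mcoeff_euler p m :
  (\sum_i 'X_i * mderiv i p)@_m = (mdeg m)%:R * p@_m.
Proof.
rewrite raddf_sum /= (eq_bigr _ (fun i _ => mcoeff_Xderiv i p m)).
by rewrite -mulr_suml -natr_sum mdegE.
Qed.

Lemma euler_homog d p : p \is d.-homog ->
  \sum_i 'X_i * mderiv i p = d%:R *: p.
Proof.
move=> hp; apply/mpolyP => m; rewrite mcoeff_euler mcoeffZ.
have [->//|ne] := eqVneq (mdeg m) d.
by rewrite (dhomog_nemf_coeff hp ne) !mulr0.
Qed.

Lemma mderiv_homog d p i : p \is d.+1.-homog -> mderiv i p \is d.-homog.
Proof.
move=> /dhomogP hp; apply/dhomogP => m; rewrite mcoeff_msupp mcoeff_mderiv => nz.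
suff /hp : (m + U_(i))%MM \in msupp p by rewrite /= mdegD mdeg1 addn1 => -[].
by rewrite mcoeff_msupp; apply: contraNneq nz => ->; rewrite mul0rn.
Qed.

Lemma homog0_const p : p \is 0.-homog -> p = (p@_0)%:MP.
Proof.
move=> hp; apply/mpolyP => m; rewrite mcoeffC.
have [->|ne] := eqVneq m 0%MM; first by rewrite mulr1.
by rewrite mulr0; apply: (dhomog_nemf_coeff hp); rewrite mdeg_eq0.
Qed.

Lemma homogX i : ('X_i : {mpoly K[n]}) \is 1.-homog.
Proof. by rewrite dhomogX /= mdeg1. Qed.

Lemma comp_homog k (t : n.-tuple {mpoly K[k]}) d p :
  (forall i, tnth t i \is 1.-homog) -> p \is d.-homog -> p \mPo t \is d.-homog.
Proof.
move=> ht /dhomogP hp; rewrite comp_mpolyEX big_seq rpred_sum // => m /hp /= <-.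
rewrite mdegE; apply: dhomogZ; rewrite comp_mpolyX.
apply: (big_ind2 (fun (q : {mpoly K[k]}) e => q \is e.-homog)) => [|p1 e1 p2 e2|i _].
- exact: dhomog1.
- exact: dhomogM.
by rewrite -[X in X.-homog]mul1n; apply: dhomogMn.
Qed.

Lemma meval0E p : p.@[fun=> 0] = p@_0%MM.
Proof.
elim/mpolyind: p => [|c m p _ _ IH]; first by rewrite meval0 mcoeff0.
rewrite mevalD IH mcoeffD; congr (_ + _); rewrite mevalZ mevalX mcoeffZ mcoeffX.
congr (_ * _); case: eqP => [->|/eqP]; first by rewrite big1 // => i _; rewrite mnm0E.
rewrite -mdeg_eq0 mdegE sum_nat_eq0 negb_forall => /existsP[i /= nz].
by rewrite (bigD1 i) //= expr0n (negPf nz) mul0r.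
Qed.

(* Lowest terms: comparing coefficients degree by degree, [q@_0 != 0] forces
   [p] to vanish below degree [N]. *)
Lemma homog_mul_unit N p q : p != 0 -> q@_0 != 0 -> p * q \is N.-homog ->
  p \is N.-homog /\ q = (q@_0)%:MP.
Proof.
move=> p0 q00 hpq; have q0 : q != 0 by apply: contraNneq q00 => ->; rewrite mcoeff0.
have low d m : (mdeg m < d)%N -> (mdeg m < N)%N -> p@_m = 0.
  elim: d m => // d IH m lmd lmN.
  have := dhomog_nemf_coeff hpq (m := m); rewrite (ltn_eqF lmN) => /(_ isT).
  pose i0 : 'X_{1..n < (mdeg m).+1} := BMultinom (ltnSn (mdeg m)).
  have l0 : (mdeg (0%MM : 'X_{1..n}) < (mdeg m).+1)%N by rewrite mdeg0.
  rewrite mcoeffM (bigD1 (i0, BMultinom l0)) /= ?addm0 //.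
  rewrite big1 ?addr0 => [/eqP|[k1 k2] /= /andP[/eqP em ne]].
    by rewrite mulf_eq0 (negPf q00) orbF => /eqP.
  have k20 : bmnm k2 != 0%MM.
    apply: contraNneq ne => e2; apply/eqP; congr (_, _); apply: val_inj => //=.
    by apply/esym; apply: (etrans em); rewrite e2 addm0.
  have lt : (mdeg k1 < mdeg m)%N.
    move: (congr1 (@mdeg n) em) k20; rewrite mdegD -mdeg_eq0; lia.
  have ltd : (mdeg k1 < d)%N by lia.
  have ltN : (mdeg k1 < N)%N by lia.
  by rewrite (IH _ ltd ltN) mul0r.
(* The leading degrees add up to [N], while [p] has nothing below degree [N]; hence [p] stops at [N]
   and [q] has degree 0. *)
have e : (mdeg (mlead p) + mdeg (mlead q))%N = N.
  have pq0 : p * q != 0 by rewrite mulf_neq0.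
  by rewrite -mdegD -mleadM //; apply: (dhomog_mf hpq); apply: mlead_supp.
have lo m : m \in msupp p -> (N <= mdeg m)%N.
  rewrite mcoeff_msupp leqNgt => nz; apply: contraNN nz => lt.
  by rewrite (low _ _ (ltnSn _) lt).
have lN := lo _ (mlead_supp p0).
have degle (r : {mpoly K[n]}) m : m \in msupp r -> (mdeg m <= mdeg (mlead r))%N.
  move=> mr; have r0 : r != 0 by apply: contraTneq mr => ->; rewrite msupp0.
  by rewrite -ltnS mlead_deg // msize_mdeg_lt.
split.
  apply/dhomogP => m mp; apply/eqP; rewrite eqn_leq lo // andbT.
  by rewrite (leq_trans (degle _ _ mp)) // -e leq_addr.
apply: homog0_const; apply/dhomogP => m /degle /=; lia.
Qed.

Section Char0.
Hypothesis char0 : forall k, (k%:R == 0 :> K) = (k == 0)%N.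

Lemma const_of_euler0 p : \sum_i 'X_i * mderiv i p = 0 -> p = (p@_0)%:MP.
Proof.
move=> e; apply: homog0_const; apply/dhomogP => m; rewrite mcoeff_msupp => nz.
have := congr1 (mcoeff m) e; rewrite mcoeff_euler mcoeff0 => /eqP.
by rewrite mulf_eq0 (negPf nz) orbF char0 => /eqP.
Qed.

Lemma const_of_mderiv0 p : (forall i, mderiv i p = 0) -> p = (p@_0)%:MP.
Proof. by move=> e; apply: const_of_euler0; apply: big1 => i _; rewrite e mulr0. Qed.

(** The Euler operator scales each monomial by its degree, so in characteristic 0 it is invertible
    away from the constants. It kills the constant term, which therefore has to be subtracted. *)
Lemma euler_eq_homog d p q : (0 < d)%N -> q \is d.-homog ->
  \sum_i 'X_i * mderiv i p = q -> d%:R *: (p - (p@_0)%:MP) = q.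
Proof.
move=> d0 hq e; apply/mpolyP => m; rewrite -e mcoeff_euler mcoeffZ mcoeffB mcoeffC.
have [->|ne] := eqVneq m 0%MM.
  by rewrite mulr1 subrr mdeg0 mul0r mulr0.
rewrite mulr0 subr0; have [->//|nd] := eqVneq (mdeg m) d.
have := dhomog_nemf_coeff hq nd; rewrite -e mcoeff_euler => /eqP.
rewrite mulf_eq0 char0 mdeg_eq0 (negPf ne) /= => /eqP ->.
by rewrite !mulr0.
Qed.

(* After cancelling leading terms, the leading monomials of [p] and [q] differ
   in some variable [i], where the [i]-th equation fails. *)
Lemma proportional_of_mderiv p q : q != 0 ->
  (forall i, q * mderiv i p = p * mderiv i q) -> exists c, p = c *: q.
Proof.
move=> q0 e; pose c := p@_(mlead q) / q@_(mlead q); exists c.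
have lq : q@_(mlead q) != 0 by rewrite mleadc_eq0.
apply/eqP; rewrite -subr_eq0; set r := p - c *: q.
have er i : q * mderiv i r = r * mderiv i q.
  by rewrite /r mderivB mderivZ mulrBr e mulrBl -scalerAl -scalerAr.
have rq : r@_(mlead q) = 0 by rewrite mcoeffB mcoeffZ /c divfK ?subrr.
apply: contraT => r0; have lr : r@_(mlead r) != 0 by rewrite mleadc_eq0.
have ne : mlead r != mlead q by apply: contraNneq lr => ->; rewrite rq.
have [i ni] : exists i, mlead r i != mlead q i.
  apply/existsP; rewrite -negb_forall; apply: contraNN ne => /forallP E.
  by apply/eqP/mnmP => i; apply/eqP.
have leX (s : {mpoly K[n]}) : (mlead ('X_i * mderiv i s) <= mlead s)%O.
  have [->|s0] := eqVneq ('X_i * mderiv i s) 0; first by rewrite mlead0 le0x.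
  apply: msupp_le_mlead; have := mlead_supp s0; rewrite !mcoeff_msupp.
  rewrite mcoeff_Xderiv; set m := mlead _ => nz.
  by apply: contraNneq nz => ->; rewrite mulr0.
have E : q * ('X_i * mderiv i r) = r * ('X_i * mderiv i q).
  by rewrite mulrCA er mulrCA.
have := congr1 (mcoeff (mlead r + mlead q)%MM) E.
rewrite {1}addmC !mleadcMW ?mcoeff_Xderiv // => /eqP.
rewrite mulrCA [X in _ == X]mulrCA -subr_eq0 [q@__ * _]mulrC -mulrBl.
rewrite mulf_eq0 (mulf_eq0 r@__) (negPf lr) (negPf lq) !orbF subr_eq0.
have natr_inj a b : (a <= b)%N -> a%:R = b%:R :> K -> a = b.
  move=> lab /eqP; rewrite eq_sym -subr_eq0 -natrB // char0 => /eqP; lia.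
move=> /eqP H; case/orP: (leq_total (mlead r i) (mlead q i)) => l.
  by rewrite (natr_inj _ _ l H) eqxx in ni.
by rewrite (natr_inj _ _ l (esym H)) eqxx in ni.
Qed.

End Char0.
End MPolyGeneral.

(** * Divisibility by linear forms *)

Section LinearForms.
Variables (n : nat) (K : fieldType).
Implicit Types (l a b p q : {mpoly K[n]}) (s : seq {mpoly K[n]}).

Definition mdvd l a := exists q, a = q * l.

Lemma linear_formE l : l \is 1.-homog -> l = \sum_i l@_U_(i) *: 'X_i.
Proof.
move=> hl; rewrite -{1}[l]scale1r -[1]/(1%:R) -(euler_homog hl).
apply: eq_bigr => i _; rewrite (homog0_const (mderiv_homog i hl)).
by rewrite mcoeff_mderiv mnm0E add0m mulrC mul_mpolyC.
Qed.

Lemma linear_form_neq0 l : l \is 1.-homog -> l != 0 -> exists j, l@_U_(j) != 0.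
Proof.
move=> hl l0; apply/existsP; rewrite -negb_forall; apply: contraNN l0 => /forallP l_eq0.
by rewrite (linear_formE hl) big1 // => i _; rewrite (eqP (l_eq0 i)) scale0r.
Qed.

(* The retraction onto the hyperplane [l = 0] that solves [l] for ['X_j]. *)
Definition hyp_retract l j : n.-tuple {mpoly K[n]} :=
  [tuple 'X_i - (i == j)%:R *: ((l@_U_(j))^-1 *: l) | i < n].

Lemma hyp_retract_id l j a : mdvd l (a - (a \mPo hyp_retract l j)).
Proof.
elim/mpoly_ring_ind: a => [c|i|a b [q1 e1] [q2 e2]|a b [q1 e1] [q2 e2]].
- by exists 0; rewrite comp_mpolyC subrr mul0r.
- exists ((i == j)%:R * (l@_U_(j))^-1)%:MP; rewrite comp_mpolyXU -tnth_nth tnth_mktuple.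
  by rewrite opprB addrC subrK scalerA mul_mpolyC.
- by exists (q1 + q2); rewrite comp_mpolyD mulrDl -e1 -e2; ring.
exists (q1 * b + (a \mPo hyp_retract l j) * q2).
rewrite rmorphM /=; set ra := a \mPo _ in e1 *; set rb := b \mPo _ in e2 *.
have -> : (q1 * b + ra * q2) * l = (q1 * l) * b + ra * (q2 * l) by ring.
by rewrite -e1 -e2; ring.
Qed.

Lemma hyp_retract_dvd l j a : l \is 1.-homog -> l@_U_(j) != 0 ->
  (a \mPo hyp_retract l j = 0) <-> mdvd l a.
Proof.
move=> hl lj; split=> [a0|[q ->]].
  by have := hyp_retract_id l j a; rewrite a0 subr0.
suff l0 : l \mPo hyp_retract l j = 0 by rewrite rmorphM /= l0 mulr0.
set t := hyp_retract l j; rewrite [l in l \mPo _](linear_formE hl) raddf_sum /=.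
rewrite (eq_bigr (fun i => l@_U_(i) *: 'X_i -
  ((i == j)%:R * l@_U_(i) / l@_U_(j)) *: l)).
  rewrite sumrB -(linear_formE hl) -scaler_suml (bigD1 j) //= eqxx mul1r divff //.
  rewrite big1 ?addr0 ?scale1r ?subrr // => i ne.
  by rewrite (negPf ne) !mul0r.
move=> i _; rewrite comp_mpolyZ comp_mpolyXU -tnth_nth tnth_mktuple.
by rewrite scalerBr !scalerA mulrA [_ * _%:R]mulrC.
Qed.

(** Divisibility by [l] is vanishing under a ring morphism to a domain, the retraction onto the
    hyperplane. *)
Lemma linear_prime l a b : l \is 1.-homog -> l != 0 ->
  mdvd l (a * b) -> mdvd l a \/ mdvd l b.
Proof.
move=> hl l0; have [j lj] := linear_form_neq0 hl l0.
move=> /(hyp_retract_dvd _ hl lj) /eqP; rewrite rmorphM /= mulf_eq0.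
by case/orP => /eqP /(hyp_retract_dvd _ hl lj); [left | right].
Qed.

Lemma mul_const_const a b c : c != 0 -> a * b = c%:MP -> exists2 e, e != 0 & a = e%:MP.
Proof.
move=> c0 e; have : a * b != 0 by rewrite e mpolyC_eq0.
rewrite mulf_eq0 negb_or => /andP[a0 b0].
have := mleadM a0 b0; rewrite e mleadC => /esym/eqP.
rewrite mnmD_eq0 => /andP[/eqP la _]; exists a@_0; first by rewrite -la mleadc_eq0.
apply: homog0_const; apply/dhomogP => m /msize_mdeg_lt.
by rewrite -(mlead_deg a0) la mdeg0 ltnS leqn0 => /eqP.
Qed.

(** This takes the place of unique factorization: each linear factor is prime and is cancelled from
    one side or the other. The inclusion forgets multiplicities; degree counts recover what is
    needed of them. *)
Lemma dvd_prod_linear s a b c :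
  (forall l, l \in s -> l \is 1.-homog /\ l != 0) -> c != 0 ->
  a * b = c *: \prod_(l <- s) l ->
  exists c' s', [/\ c' != 0, {subset s' <= s} & a = c' *: \prod_(l <- s') l].
Proof.
elim: s a b => [|l s IH] a b hs c0.
  rewrite big_nil -mul_mpolyC mulr1 => /(mul_const_const c0)[e e0 ->].
  by exists e, [::]; rewrite big_nil -mul_mpolyC mulr1.
have [hl l0] := hs l (mem_head _ _).
have hs' k : k \in s -> k \is 1.-homog /\ k != 0.
  by move=> ks; apply: hs; rewrite inE ks orbT.
rewrite big_cons => e; have : mdvd l (a * b).
  by exists (c *: \prod_(k <- s) k); rewrite e -scalerAl mulrC.
case/(linear_prime hl l0) => [[q eq]|[q eq]].
  have : q * b = c *: \prod_(k <- s) k.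
    by apply: (mulfI l0); rewrite mulrA [l * q]mulrC -eq e scalerAr.
  move=> /(IH _ _ hs' c0) [c' [s' [c'0 sub eq']]].
  exists c', (l :: s'); split=> //.
    by move=> k; rewrite !inE => /orP[->//|/sub ->]; rewrite orbT.
  by rewrite eq eq' big_cons -scalerAl mulrC.
have : a * q = c *: \prod_(k <- s) k.
  by apply: (mulfI l0); rewrite mulrCA [l * q]mulrC -eq e scalerAr.
move=> /(IH _ _ hs' c0) [c' [s' [c'0 sub ea]]].
by exists c', s'; split=> // k /sub ks; rewrite inE ks orbT.
Qed.

Lemma prod_linear_homog s : (forall l, l \in s -> l \is 1.-homog) ->
  \prod_(l <- s) l \is (size s).-homog.
Proof.
elim: s => [|l s IH] hs; first by rewrite big_nil dhomog1.
rewrite big_cons /= -add1n; apply: dhomogM; first exact: hs (mem_head _ _).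
by apply: IH => k ks; apply: hs; rewrite inE ks orbT.
Qed.

Lemma prod_seq3 s (x y z : {mpoly K[n]}) : {subset s <= [:: x; y; z]} ->
  exists i j k : nat, \prod_(l <- s) l = x ^+ i * y ^+ j * z ^+ k.
Proof.
elim: s => [|l s IH] sub; first by exists 0%N, 0%N, 0%N; rewrite big_nil !mulr1.
have [|i [j [k e]]] := IH; first by move=> r rs; apply: sub; rewrite inE rs orbT.
have := sub l (mem_head _ _); rewrite big_cons e !inE => /or3P[] /eqP ->.
- by exists i.+1, j, k; rewrite exprS; ring.
- by exists i, j.+1, k; rewrite exprS; ring.
by exists i, j, k.+1; rewrite exprS; ring.
Qed.

End LinearForms.

(** * Elements algebraic over the subring generated by a tuple *)

Section Algebraic.
Variables (n k : nat) (K : fieldType).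
Variable t : n.-tuple {mpoly K[k]}.
Implicit Types (F : {poly {mpoly K[k]}}) (u : {mpoly K[k]}).

Definition over_image F := forall i, exists c, F`_i = c \mPo t.

(** Chain rule, with [B] collecting the derivatives of the coefficients. The point is that [B] does
    not depend on [j], so this is an identity between gradients. *)
Lemma mderiv_horner_over_image F u : over_image F -> exists B : 'I_n -> {mpoly K[k]},
  forall j, mderiv j F.[u] =
    F^`().[u] * mderiv j u + \sum_i B i * mderiv j (tnth t i).
Proof.
elim/poly_ind: F => [|F c IH] hF.
  exists (fun=> 0) => j; rewrite deriv0 !horner0 mderiv0 mul0r add0r big1 // => i _.
  by rewrite mul0r.
have [|B eB] := IH.
  by move=> i; have [e] := hF i.+1; rewrite coefD coefMX coefC /= addr0 => ->; exists e.
have [e] := hF 0%N; rewrite coefD coefMX coefC /= add0r => ec.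
exists (fun i => B i * u + (mderiv i e \mPo t)) => j.
rewrite !hornerE derivD derivM derivX derivC !hornerE mderivD mderivM eB ec mderiv_comp.
rewrite [X in _ = _ + X](eq_bigr (fun i => (B i * mderiv j (tnth t i)) * u +
   (mderiv i e \mPo t) * mderiv j (tnth t i))); last by move=> i _; ring.
by rewrite big_split /= -mulr_suml; ring.
Qed.

(* In characteristic 0 a nonzero polynomial of least degree killing [u] has a
   derivative that does not vanish at [u]. *)
Lemma algebraic_mderiv_span F u : (forall i, (i%:R == 0 :> K) = (i == 0)%N) ->
  over_image F -> F != 0 -> F.[u] = 0 ->
  exists q (B : 'I_n -> {mpoly K[k]}), q != 0 /\
    forall j, q * mderiv j u = \sum_i B i * mderiv j (tnth t i).
Proof.
move=> char0; move: {2}(size F) (leqnn (size F)) => N.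
elim: N F => [|N IH] F szF hF F0 Fu.
  by rewrite leqn0 size_poly_eq0 (negPf F0) in szF.
have [|nz] := eqVneq F^`().[u] 0; last first.
  have [B eB] := mderiv_horner_over_image u hF.
  exists F^`().[u], (fun i => - B i); split=> // j.
  have := eB j; rewrite Fu mderiv0 => /esym/eqP; rewrite addr_eq0 => /eqP ->.
  by rewrite -sumrN; apply: eq_bigr => i _; rewrite mulNr.
apply: IH.
- by rewrite -ltnS; apply: leq_trans szF; apply: lt_size_deriv.
- by move=> i; have [c ec] := hF i.+1; exists (c *+ i.+1); rewrite coef_deriv ec raddfMn.
(* A nonzero constant has no root, so [F] has positive degree; the top coefficient of its derivative
   is that degree times the leading coefficient of [F]. *)
have sz1 : (1 < size F)%N.
  rewrite ltnNge; apply: contraNN F0 => sz; move: Fu.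
  by rewrite (size1_polyC sz) hornerC => ->; rewrite polyC0.
apply/eqP => /polyP /(_ (size F).-2); rewrite coef_deriv coef0.
have -> : (size F).-2.+1 = (size F).-1 by rewrite prednK // -subn1 subn_gt0.
rewrite -mulr_natr -mpolyC_nat => /eqP; rewrite mulf_eq0 -lead_coefE lead_coef_eq0.
by rewrite (negPf F0) mpolyC_eq0 char0 /= => /eqP; move: sz1; case: (size F) => [|[]].
Qed.

End Algebraic.

(** * Jacobian determinants and the Casimir equation *)

Section Jacobian.
Variable K : fieldType.
Local Notation P := {mpoly K[3]}.
Implicit Types (a b c p q Om : P) (t : 3.-tuple P).

Lemma ord3P (Q : 'I_3 -> Prop) : Q 0 -> Q 1 -> Q 2 -> forall i, Q i.
Proof.
move=> Q0 Q1 Q2 [[|[|[|//]]] lt3].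
- by have -> : Ordinal lt3 = 0 by apply: val_inj.
- by have -> : Ordinal lt3 = 1 by apply: val_inj.
by have -> : Ordinal lt3 = 2 by apply: val_inj.
Qed.

Lemma sum_ord3 (V : nmodType) (F : 'I_3 -> V) : \sum_i F i = F 0 + F 1 + F 2.
Proof.
rewrite !big_ord_recl big_ord0 addr0 addrA; congr (_ + _ + _); congr F; exact: val_inj.
Qed.

(** The bracket [pbr] is already the determinant of three gradients; here its potential becomes an
    ordinary third argument. *)
Definition jac a b c : P := pbr c a b.

Definition jact t : P := jac (tnth t 0) (tnth t 1) (tnth t 2).

Lemma jacC a b c : jac a b c = jac b c a.
Proof. by rewrite /jac /pbr; ring. Qed.

Lemma jac_swap a b c : jac a b c = - jac b a c.
Proof. by rewrite /jac /pbr; ring. Qed.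

Lemma jacD a a' b c : jac (a + a') b c = jac a b c + jac a' b c.
Proof. by rewrite /jac /pbr /d1 /d2 /d3 !mderivD; ring. Qed.

Lemma jacN a b c : jac (- a) b c = - jac a b c.
Proof. by rewrite /jac /pbr /d1 /d2 /d3 !mderivN; ring. Qed.

Lemma jacZ k a b c : jac (k *: a) b c = k *: jac a b c.
Proof. by rewrite /jac /pbr /d1 /d2 /d3 !mderivZ -!mul_mpolyC; ring. Qed.

Lemma jac_const k b c : jac k%:MP b c = 0.
Proof. by rewrite /jac /pbr /d1 /d2 /d3 !mderivC; ring. Qed.

Lemma jac_X : jac 'X_0 'X_1 'X_2 = 1.
Proof. by rewrite /jac /pbr /d1 /d2 /d3 !mderivXU /=; ring. Qed.

Lemma jac_homog a b c i j k : a \is i.+1.-homog -> b \is j.+1.-homog ->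
  c \is k.+1.-homog -> jac a b c \is (i + j + k)%N.-homog.
Proof.
move=> ha hb hc; rewrite /jac /pbr /d1 /d2 /d3 -addnA.
by apply: rpredD; first apply: rpredB; apply: dhomogM; rewrite ?mderiv_homog //;
  apply: rpredB; apply: dhomogM; rewrite mderiv_homog.
Qed.

Lemma mderiv_comp3 t j p : mderiv j (p \mPo t) =
  (d1 p \mPo t) * mderiv j (tnth t 0) + (d2 p \mPo t) * mderiv j (tnth t 1) +
  (d3 p \mPo t) * mderiv j (tnth t 2).
Proof. by rewrite mderiv_comp sum_ord3. Qed.

(** Multiplicativity of the determinant, expanded so that it applies both to the chain rule and to
    the Vandermonde computation with the orbit polynomials. *)
Lemma det3_mul (R : comNzRingType) (a1 a2 a3 b1 b2 b3 c1 c2 c3 : R)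
    (x1 x2 x3 y1 y2 y3 z1 z2 z3 : R) :
  let det u1 u2 u3 v1 v2 v3 w1 w2 w3 :=
    u1 * (v2 * w3 - v3 * w2) - u2 * (v1 * w3 - v3 * w1) + u3 * (v1 * w2 - v2 * w1) in
  let row u1 u2 u3 w1 w2 w3 : R := u1 * w1 + u2 * w2 + u3 * w3 in
  det (row a1 a2 a3 x1 y1 z1) (row a1 a2 a3 x2 y2 z2) (row a1 a2 a3 x3 y3 z3)
      (row b1 b2 b3 x1 y1 z1) (row b1 b2 b3 x2 y2 z2) (row b1 b2 b3 x3 y3 z3)
      (row c1 c2 c3 x1 y1 z1) (row c1 c2 c3 x2 y2 z2) (row c1 c2 c3 x3 y3 z3) =
  det a1 a2 a3 b1 b2 b3 c1 c2 c3 * det x1 x2 x3 y1 y2 y3 z1 z2 z3.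
Proof. by move=> det row; rewrite /det /row; ring. Qed.

Lemma jac_comp t a b c :
  jac (a \mPo t) (b \mPo t) (c \mPo t) = (jac a b c \mPo t) * jact t.
Proof.
have E j p : mderiv j (p \mPo t) = _ := mderiv_comp3 t j p.
rewrite /jact /jac /pbr !(rmorphD, rmorphN, rmorphM) /=.
rewrite [d1 (a \mPo t)]E [d2 (a \mPo t)]E [d3 (a \mPo t)]E.
rewrite [d1 (b \mPo t)]E [d2 (b \mPo t)]E [d3 (b \mPo t)]E.
rewrite [d1 (c \mPo t)]E [d2 (c \mPo t)]E [d3 (c \mPo t)]E.
exact: det3_mul.
Qed.

(* This is Cramer's identity for the gradients of [t] and of [Om]. *)
Lemma poisson_hom_gradient Om t :
  (forall a b, pbr Om a b \mPo t = pbr Om (a \mPo t) (b \mPo t)) ->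
  forall j, mderiv j (Om \mPo t) = jact t * mderiv j Om.
Proof.
move=> hbr; have tX i : 'X_i \mPo t = tnth t i by rewrite comp_mpolyXU -tnth_nth.
(* Each partial derivative of [Om] is a bracket of two coordinates, so the chain rule expresses the
   gradient of [Om(t)] by brackets of entries of [t]. *)
have e1 : d1 Om \mPo t = pbr Om (tnth t 1) (tnth t 2).
  by rewrite -!tX -hbr; congr (_ \mPo t); rewrite /pbr /d1 /d2 /d3 !mderivXU /=; ring.
have e2 : d2 Om \mPo t = pbr Om (tnth t 2) (tnth t 0).
  by rewrite -!tX -hbr; congr (_ \mPo t); rewrite /pbr /d1 /d2 /d3 !mderivXU /=; ring.
have e3 : d3 Om \mPo t = pbr Om (tnth t 0) (tnth t 1).
  by rewrite -!tX -hbr; congr (_ \mPo t); rewrite /pbr /d1 /d2 /d3 !mderivXU /=; ring.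
move=> j; rewrite mderiv_comp3 e1 e2 e3 /jact /jac /pbr.
by elim/ord3P: j; rewrite /d1 /d2 /d3; ring.
Qed.

Lemma mderivXS (p : P) k i : mderiv i (p ^+ k.+1) = k.+1%:R * p ^+ k * mderiv i p.
Proof.
elim: k => [|k IH]; first by rewrite expr1 expr0 !mul1r.
by rewrite exprS mderivM IH [p ^+ k.+1]exprS [k.+2%:R]mulrS; ring.
Qed.

Section Casimir.
Hypothesis char0 : forall k, (k%:R == 0 :> K) = (k == 0)%N.
Variables (Om : P) (t : 3.-tuple P) (N : nat).
Hypotheses (Om0 : Om != 0) (hOm : Om \is 3.-homog).
Hypotheses (J0 : jact t != 0) (hJ : jact t \is N.-homog).
Hypothesis gradOm : forall j, mderiv j (Om \mPo t) = jact t * mderiv j Om.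

Lemma comp_Om_eq :
  (N + 3)%:R *: (Om \mPo t - ((Om \mPo t)@_0)%:MP) = 3%:R *: (jact t * Om).
Proof.
apply: (euler_eq_homog char0); first by rewrite addn3.
  by apply: dhomogZ; apply: dhomogM.
rewrite (eq_bigr (fun i => jact t * ('X_i * mderiv i Om))); last first.
  by move=> i _; rewrite gradOm; ring.
by rewrite -mulr_sumr (euler_homog hOm) scalerAr.
Qed.

(** Differentiating [comp_Om_eq] gives [(N + 3) J dOm = 3 (J dOm + Om dJ)]; the terms [3 J dOm]
    cancel. *)
Lemma jact_log_derivative j :
  N%:R * (jact t * mderiv j Om) = 3%:R * (Om * mderiv j (jact t)).
Proof.
have := congr1 (mderiv j) comp_Om_eq.
rewrite !mderivZ mderivB mderivC subr0 gradOm mderivM -!mul_mpolyC !mpolyC_nat natrD.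
move=> e; rewrite -[LHS]addr0 -(subrr (3%:R * (jact t * mderiv j Om))) addrA.
by rewrite -mulrDl e; ring.
Qed.

(** Both sides have the same logarithmic derivative, hence are proportional in characteristic 0. *)
Lemma jact_cube : exists2 c : K, c != 0 & jact t ^+ 3 = c *: Om ^+ N.
Proof.
have [c e] : exists c : K, jact t ^+ 3 = c *: Om ^+ N.
  apply: (proportional_of_mderiv char0); first by rewrite expf_neq0.
  move=> i; rewrite (mderivXS _ 2).
  have := jact_log_derivative i; case: N => [|M] /= e.
    have -> : mderiv i (Om ^+ 0) = 0 by rewrite expr0 -mpolyC1 mderivC.
    have /eqP : 3%:R * (Om * mderiv i (jact t)) = 0 by rewrite -e mul0r.
    rewrite mulf_eq0 -mpolyC_nat mpolyC_eq0 char0 /= mulf_eq0 (negPf Om0) /= => /eqP ->.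
    by rewrite !mulr0.
  rewrite mderivXS exprS.
  transitivity (Om ^+ M * jact t ^+ 2 * (3%:R * (Om * mderiv i (jact t)))); first by ring.
  by rewrite -e; ring.
exists c => //; apply: contraNneq (expf_neq0 3 J0) => c0.
by rewrite e c0 scale0r.
Qed.

End Casimir.

(** * Homogeneous substitutes for the generators *)

Section HomogeneousGenerators.
Variable t : 3.-tuple P.
Hypothesis t_inj : injective (comp_mpoly t).
Hypothesis t_graded : forall a d, exists b, b \mPo t = pihomog mdeg d (a \mPo t).

(** The Jacobian is additive in its first slot and [a(t)] is the sum of its components, each again a
    polynomial in [t]. If all components gave 0 at [v], so would [a]; the induction peels off the
    top component. *)
Lemma select_component (v : 'I_3 -> K) a b c : (jac a b c).@[v] != 0 ->
  exists a' d, (a' \mPo t \is d.-homog) /\ (jac a' b c).@[v] != 0.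
Proof.
suff main k a' : a' \mPo t = \sum_(d < k) pihomog mdeg d (a \mPo t) ->
    (jac a' b c).@[v] != 0 -> exists a'' d, (a'' \mPo t \is d.-homog) /\
      (jac a'' b c).@[v] != 0.
  by apply: (main (msize (a \mPo t))); rewrite -pihomog_partitionE.
elim: k a' => [|k IH] a' e.
  have -> : a' = 0 by apply: t_inj; rewrite e big_ord0 comp_mpoly0.
  by rewrite -mpolyC0 jac_const meval0 eqxx.
move=> nz; have [a1 e1] := t_graded a k.
have [z1|] := eqVneq (jac a1 b c).@[v] 0; last first.
  by move=> nz1; exists a1, k; split=> //; rewrite e1 pihomogP.
apply: (IH (a' - a1)); first by rewrite comp_mpolyB e e1 big_ord_recr /= addrK.
by rewrite jacD jacN mevalB z1 subr0.
Qed.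

(** The product [jac(a)(t) * J] is the Jacobian of the homogeneous [a_i(t)], and its first factor
    has a nonzero constant term, so [homog_mul_unit] applies. *)
Lemma jact_homog a1 a2 a3 e1 e2 e3 : jact t != 0 ->
  a1 \mPo t \is e1.-homog -> a2 \mPo t \is e2.-homog -> a3 \mPo t \is e3.-homog ->
  (jac a1 a2 a3).@[fun i => (tnth t i)@_0] != 0 ->
  exists N, [/\ (e1 + e2 + e3 = N + 3)%N, (0 < e1)%N, (0 < e2)%N, (0 < e3)%N &
    jact t \is N.-homog].
Proof.
move=> J0 h1 h2 h3 nz.
have const a e b c : a \mPo t \is e.-homog ->
    (jac a b c).@[fun i => (tnth t i)@_0] != 0 -> (0 < e)%N.
  case: e => // /homog0_const e; rewrite (_ : a = ((a \mPo t)@_0)%:MP).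
    by rewrite jac_const meval0 eqxx.
  by apply: t_inj; rewrite {1}e comp_mpolyC.
have l1 : (0 < e1)%N := const _ _ _ _ h1 nz.
have l2 : (0 < e2)%N by apply: (const _ _ a3 a1 h2); rewrite -jacC.
have l3 : (0 < e3)%N by apply: (const _ _ a1 a2 h3); rewrite jacC.
case: e1 e2 e3 l1 l2 l3 h1 h2 h3 => // e1 [//|e2] [//|e3] _ _ _ h1 h2 h3.
exists (e1 + e2 + e3)%N; split=> //; first by lia.
have := jac_homog h1 h2 h3; rewrite jac_comp mulrC => h.
have q0 : (jac a1 a2 a3 \mPo t)@_0 != 0.
  rewrite -meval0E comp_mpoly_meval.
  by rewrite (@meval_eq _ _ _ (fun i => (tnth t i)@_0)) // => i; rewrite meval0E.
by case: (homog_mul_unit J0 q0 h).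
Qed.

End HomogeneousGenerators.
End Jacobian.

(** * The finite group as linear substitutions, and its orbit polynomials *)

Section LinearGroup.
Variable K : fieldType.
Hypothesis char0 : forall k, (k%:R == 0 :> K) = (k == 0)%N.
Local Notation P := {mpoly K[3]}.

Definition idt : 3.-tuple P := [tuple 'X_i | i < 3].
Definition mulT (s g : 3.-tuple P) : 3.-tuple P := [tuple tnth s i \mPo g | i < 3].

Lemma pihomog_comp (g : 3.-tuple P) d (a : P) : (forall i, tnth g i \is 1.-homog) ->
  pihomog mdeg d a \mPo g = pihomog mdeg d (a \mPo g).
Proof.
move=> hg; elim/mpolyind: a => [|c m a _ _ IH].
  by rewrite comp_mpoly0 !pihomog0 comp_mpoly0.
rewrite pihomogD comp_mpolyD IH comp_mpolyD pihomogD; congr (_ + _).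
rewrite linearZ /= !comp_mpolyZ linearZ /= pihomogX; congr (_ *: _).
have hm : 'X_[m] \mPo g \is (mdeg m).-homog by apply: comp_homog; rewrite // dhomogX.
have [<-|ne] := eqVneq (mdeg m) d; first by rewrite pihomog_dE.
by rewrite comp_mpoly0 (pihomog_ne0 ne hm).
Qed.

Lemma mpoly_nat_eq0 k : (k%:R == 0 :> P) = (k == 0)%N.
Proof. by rewrite -mpolyC_nat mpolyC_eq0 char0. Qed.

Lemma poly_nat_nonroot (q : {poly P}) : q != 0 ->
  exists k0, forall k, (k0 <= k)%N -> q.[k%:R] != 0.
Proof.
move: {2}(size q) (leqnn (size q)) => N; elim: N q => [|N IH] q sz q0.
  by rewrite leqn0 size_poly_eq0 (negPf q0) in sz.
have [[k rk]|noroot] := classic (exists k, root q k%:R); last first.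
  by exists 0%N => k _; apply/negP => rk; apply: noroot; exists k.
have [r er] := factor_theorem q k%:R rk; subst q.
have r0 : r != 0 by apply: contraNneq q0 => ->; rewrite mul0r.
have [|//|k0 hk0] := IH r.
  by rewrite size_Mmonic ?monicXsubC // size_XsubC addn2 /= ltnS in sz.
exists (maxn k0 k.+1) => k'; rewrite geq_max => /andP[le0 lek].
rewrite hornerM hornerXsubC mulf_neq0 ?hk0 // -natrB ?mpoly_nat_eq0 1?ltnW //.
by rewrite subn_eq0 -ltnNge.
Qed.

Variable S : seq (3.-tuple P).
Hypothesis S_uniq : uniq S.
Hypothesis S_id : idt \in S.
Hypothesis S_mul : forall s g, s \in S -> g \in S -> mulT s g \in S.
Hypothesis S_inj : forall g, g \in S -> injective (comp_mpoly g).
Hypothesis S_lin : forall g i, g \in S -> tnth g i \is 1.-homog.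

Variable t : 3.-tuple P.
Hypothesis invP : forall a, (forall g, g \in S -> a \mPo g = a) <-> exists b, a = b \mPo t.

Lemma S_perm g : g \in S -> perm_eq [seq mulT s g | s <- S] S.
Proof.
move=> gS; have mul_inj : injective (mulT^~ g).
  move=> s s' /(congr1 (fun u : 3.-tuple P => tnth u)) e; apply: eq_from_tnth => i.
  by apply: (S_inj gS); have := congr1 (fun h => h i) e; rewrite !tnth_mktuple.
have um : uniq [seq mulT s g | s <- S] by rewrite map_inj_uniq.
apply: uniq_perm => //.
have sub : {subset [seq mulT s g | s <- S] <= S}.
  by move=> _ /mapP[s sS ->]; apply: S_mul.
have le : (size S <= size [seq mulT s g | s <- S])%N by rewrite size_map.
by have [] := uniq_min_size um sub le.
Qed.

(** The product runs over the whole group, not over distinct conjugates. The coefficients are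
    invariant for every [u], but the root [u] is simple only if [u] has trivial stabilizer; hence
    the need for generic linear forms. *)
Definition orbit_poly (u : P) : {poly P} := \prod_(s <- S) ('X - (u \mPo s)%:P).

Lemma orbit_poly_over_image u : over_image t (orbit_poly u).
Proof.
move=> i; apply/invP => g gS; rewrite -(coef_map (comp_mpoly g)) /=.
suff -> : map_poly (comp_mpoly g) (orbit_poly u) = orbit_poly u by [].
rewrite /orbit_poly rmorph_prod /= -[RHS](perm_big _ (S_perm gS)) big_map.
apply: eq_bigr => s _; rewrite rmorphB /= map_polyX map_polyC /=.
by rewrite comp_mpolyA.
Qed.

Lemma comp_idt u : u \mPo idt = u.
Proof. exact: comp_mpoly_id. Qed.

Lemma orbit_polyE u :
  orbit_poly u = ('X - u%:P) * \prod_(s <- rem idt S) ('X - (u \mPo s)%:P).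
Proof. by rewrite /orbit_poly (perm_big _ (perm_to_rem S_id)) big_cons comp_idt. Qed.

Lemma orbit_poly_root u : (orbit_poly u).[u] = 0.
Proof. by rewrite orbit_polyE hornerM hornerXsubC subrr mul0r. Qed.

Lemma deriv_orbit_poly u :
  (orbit_poly u)^`().[u] = \prod_(l <- [seq u - (u \mPo s) | s <- rem idt S]) l.
Proof.
rewrite orbit_polyE derivM derivXsubC mul1r hornerD hornerM hornerXsubC subrr mul0r.
by rewrite addr0 horner_prod big_map; apply: eq_bigr => s _; rewrite hornerXsubC.
Qed.

(* The norm of [v i - 'X_i] is invariant and vanishes at [v]; at the origin its
   value is a power of [v i]. *)
Lemma fiber_origin (v : 'I_3 -> K) :
  (forall i, (tnth t i).@[v] = (tnth t i)@_0) -> forall i, v i = 0.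
Proof.
move=> ev i; pose w : P := \prod_(s <- S) ((v i)%:MP - tnth s i).
have [b eb] : exists b, w = b \mPo t.
  apply/invP => g gS; rewrite /w rmorph_prod /= -[RHS](perm_big _ (S_perm gS)) big_map.
  by apply: eq_bigr => s _; rewrite rmorphB /= comp_mpolyC tnth_mktuple.
have : w.@[v] = w.@[fun=> 0].
  rewrite eb !comp_mpoly_meval; apply: meval_eq => j.
  by rewrite ev meval0E.
rewrite /w !rmorph_prod /= (perm_big _ (perm_to_rem S_id)) big_cons /=.
rewrite mevalB mevalC tnth_mktuple mevalXU subrr mul0r => /esym/eqP.
rewrite prodf_seq_eq0 => /hasP[s sS] /=; rewrite mevalB mevalC meval0E.
have -> : (tnth s i)@_0 = 0 by apply: (dhomog_nemf_coeff (S_lin i sS)); rewrite /= mdeg0.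
by rewrite subr0 => /eqP.
Qed.

(** Linear substitutions commute with taking components, so a component of an invariant is
    invariant. *)
Lemma invariants_graded a d : exists b, b \mPo t = pihomog mdeg d (a \mPo t).
Proof.
have [b ->] : exists b, pihomog mdeg d (a \mPo t) = b \mPo t; last by exists b.
apply/invP => g gS; rewrite pihomog_comp => [|i]; last exact: S_lin.
by have /invP /(_ _ gS) -> : exists b, a \mPo t = b \mPo t by exists a.
Qed.

(* Any finite set of nontrivial substitutions moves all but finitely many points
   of the moment curve, and three distinct points of it are independent. *)
Definition curve (k : nat) : P := 'X_0 + k%:R *: 'X_1 + (k ^ 2)%:R *: 'X_2.

Lemma curve_homog k : curve k \is 1.-homog.
Proof. by apply: rpredD; [apply: rpredD|]; rewrite ?rpredZ ?homogX. Qed.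

Lemma curve_comp k (g : 3.-tuple P) :
  curve k \mPo g = tnth g 0 + k%:R *: tnth g 1 + (k ^ 2)%:R *: tnth g 2.
Proof. by rewrite /curve !comp_mpolyD !comp_mpolyZ !comp_mpolyXU -!tnth_nth. Qed.

Lemma curve_generic : exists k0, forall k g, (k0 <= k)%N -> g \in rem idt S ->
  curve k - (curve k \mPo g) != 0.
Proof.
(* For fixed [g] the displacement of [curve k] is a polynomial in [k] with coefficients
   ['X_i - g_i], not all zero as [g] is not the identity. The product over [g] then has finitely
   many natural roots. *)
pose q (g : 3.-tuple P) : {poly P} := \poly_(i < 3) (('X_(inord i)) - tnth g (inord i)).
have qE g k : (q g).[k%:R] = curve k - (curve k \mPo g).
  rewrite curve_comp /curve horner_poly sum_ord3 /=.
  have -> : inord 0 = 0 :> 'I_3 by apply: val_inj; rewrite /= inordK.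
  have -> : inord 1 = 1 :> 'I_3 by apply: val_inj; rewrite /= inordK.
  have -> : inord 2 = 2 :> 'I_3 by apply: val_inj; rewrite /= inordK.
  by rewrite -!mul_mpolyC !mpolyC_nat; ring.
have q0 g : g \in rem idt S -> q g != 0.
  rewrite mem_rem_uniq // !inE => /andP[ne _]; apply: contraNneq ne => qg0.
  apply/eqP; apply: eq_from_tnth => i; rewrite tnth_mktuple; apply/esym/eqP.
  rewrite -subr_eq0; have := congr1 (fun r : {poly P} => r`_i) qg0.
  by rewrite coef_poly ltn_ord coef0 inord_val => ->.
have nz : \prod_(g <- rem idt S) q g != 0.
  by rewrite prodf_seq_neq0; apply/allP => g /q0.
have [k0 hk0] := poly_nat_nonroot nz; exists k0 => k g le gS.
have := hk0 _ le; rewrite horner_prod prodf_seq_neq0 => /allP /(_ _ gS) /=.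
by rewrite qE.
Qed.

(* Differentiating [F(u) = 0] for the orbit polynomial [F] of [u] puts
   [F'(u) grad u] in the span of the gradients of [t], and [F'(u)] is the product
   of the linear forms [u - g u] for [g != 1]. *)
Lemma jact_dvd_linear : exists (s : seq P) (b : P) (c : K),
  [/\ forall l, l \in s -> l \is 1.-homog /\ l != 0, c != 0 &
      jact t * b = c *: \prod_(l <- s) l].
Proof.
have [k gen] := curve_generic.
pose ls k := [seq curve k - (curve k \mPo g) | g <- rem idt S].
have hls k' l : (k <= k')%N -> l \in ls k' -> l \is 1.-homog /\ l != 0.
  move=> le /mapP[g gS ->]; split; last exact: gen.
  rewrite rpredB ?curve_homog // comp_homog ?curve_homog // => i.
  by apply: S_lin; apply: mem_rem gS.
have [Q eQ] : exists Q : nat -> P, forall k', Q k' = \prod_(l <- ls k') l by eexists.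
pose row (B : 'I_3 -> P) j :=
  B 0 * mderiv j (tnth t 0) + B 1 * mderiv j (tnth t 1) + B 2 * mderiv j (tnth t 2).
(* The gradient of [curve k'] is [(1, k', k' ^ 2)], a Vandermonde row. *)
have span k' : exists B,
    [/\ Q k' * 1 = row B 0, Q k' * k'%:R = row B 1 & Q k' * k'%:R ^+ 2 = row B 2].
  have [B eB] := mderiv_horner_over_image (curve k') (orbit_poly_over_image (curve k')).
  have dc j : Q k' * mderiv j (curve k') = row (fun i => - B i) j.
    have := eB j; rewrite eQ orbit_poly_root deriv_orbit_poly mderiv0 sum_ord3 => /esym/eqP.
    by rewrite addr_eq0 /row => /eqP ->; ring.
  exists (fun i => - B i); rewrite -!dc /curve !mderivD !mderivZ !mderivXU /=.
  by rewrite -!mul_mpolyC !mpolyC_nat natrX; split; ring.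
have [B0 [e00 e01 e02]] := span k; have [B1 [e10 e11 e12]] := span k.+1.
have [B2 [e20 e21 e22]] := span k.+2.
(* The constant 2 is the Vandermonde determinant of [k], [k + 1], [k + 2]. *)
exists (ls k ++ ls k.+1 ++ ls k.+2); eexists; exists 2%:R; split.
- move=> l; rewrite !mem_cat => /or3P[]; first exact: hls.
    exact: hls.
  by apply: hls; rewrite -addn2 leq_addr.
- by rewrite char0.
rewrite !big_cat /= -!eQ -mul_mpolyC mpolyC_nat.
move: e00 e01 e02 e10 e11 e12 e20 e21 e22; move: (Q k) (Q k.+1) (Q k.+2) => Q0 Q1 Q2.
move=> e00 e01 e02 e10 e11 e12 e20 e21 e22.
have -> : 2%:R * (Q0 * (Q1 * Q2)) =
   Q0 * 1 * ((Q1 * k.+1%:R) * (Q2 * k.+2%:R ^+ 2) - (Q1 * k.+1%:R ^+ 2) * (Q2 * k.+2%:R))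
 - Q0 * k%:R * ((Q1 * 1) * (Q2 * k.+2%:R ^+ 2) - (Q1 * k.+1%:R ^+ 2) * (Q2 * 1))
 + Q0 * k%:R ^+ 2 * ((Q1 * 1) * (Q2 * k.+2%:R) - (Q1 * k.+1%:R) * (Q2 * 1)).
  by rewrite [k.+2%:R]mulrS [k.+1%:R]mulrS; ring.
rewrite e00 e01 e02 e10 e11 e12 e20 e21 e22.
by rewrite mulrC; apply/esym; exact: det3_mul.
Qed.

End LinearGroup.

(** * Data stable under linear conjugation, and the factors of [Om(t)] *)

Section Core.
Variable K : fieldType.
Hypothesis char0 : forall k, (k%:R == 0 :> K) = (k == 0)%N.
Local Notation P := {mpoly K[3]}.
Local Notation X := ('X_0 : P).
Local Notation Y := ('X_1 : P).
Local Notation Z := ('X_2 : P).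
Implicit Types (Om a b l : P) (t y z : 3.-tuple P) (s : seq P).

Definition pt (x y z : K) : 'I_3 -> K := tnth [tuple x; y; z].

(* What is used of a graded embedding [t] with [N > 0] once [Om] is singular at
   [t(0)]; unlike the bracket, all of it is visibly stable under linear conjugation. *)
Record core Om t N : Prop := Core {
  core_fiber : forall v, (forall i, (tnth t i).@[v] = (tnth t i)@_0) -> forall i, v i = 0;
  core_integral : forall u, exists F, [/\ over_image t F, F \is monic & F.[u] = 0];
  core_jact0 : jact t != 0;
  core_homog : jact t \is N.-homog;
  core_pos : (0 < N)%N;
  core_comp : (N + 3)%:R *: (Om \mPo t) = 3%:R *: (jact t * Om);
  core_cube : exists2 c : K, c != 0 & jact t ^+ 3 = c *: Om ^+ N }.

Lemma tnth_comp t i : 'X_i \mPo t = tnth t i.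
Proof. by rewrite comp_mpolyXU -tnth_nth. Qed.

Lemma natK_neq0 k : (k.+1%:R : K) != 0.
Proof. by rewrite char0. Qed.

Section Conjugation.
Variables (y z : 3.-tuple P).
Hypotheses (hy : forall i, tnth y i \is 1.-homog) (hz : forall i, tnth z i \is 1.-homog).
Hypotheses (yz : forall i, tnth y i \mPo z = 'X_i) (zy : forall i, tnth z i \mPo y = 'X_i).

(** This is [t] in new coordinates, arranged so that substituting [conjt t] into [Om \mPo z] gives
    [(Om \mPo t) \mPo z]. *)
Definition conjt t : 3.-tuple P := [tuple (tnth y i \mPo t) \mPo z | i < 3].

Lemma comp_conjt t a : a \mPo conjt t = ((a \mPo y) \mPo t) \mPo z.
Proof.
rewrite 2!comp_mpolyA; apply: (congr1 (fun w => comp_mpoly w a)).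
by apply: eq_from_tnth => i; rewrite !tnth_mktuple comp_mpolyA.
Qed.

Lemma comp_zy a : (a \mPo z) \mPo y = a.
Proof.
have e : [tuple tnth z i \mPo y | i < 3] = [tuple 'X_i | i < 3].
  by apply: eq_from_tnth => i; rewrite !tnth_mktuple zy.
by rewrite comp_mpolyA e comp_mpoly_id.
Qed.

Lemma comp_yz a : (a \mPo y) \mPo z = a.
Proof.
have e : [tuple tnth y i \mPo z | i < 3] = [tuple 'X_i | i < 3].
  by apply: eq_from_tnth => i; rewrite !tnth_mktuple yz.
by rewrite comp_mpolyA e comp_mpoly_id.
Qed.

(** The Jacobians of the linear tuples [y] and [z] are constants with product 1, and they cancel. *)
Lemma jact_conjt t : jact (conjt t) = jact t \mPo z.
Proof.
have hJy : jact y = ((jact y)@_0)%:MP.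
  by apply: homog0_const; have := jac_homog (hy 0) (hy 1) (hy 2).
have : jact y * jact z = 1.
  have := jac_comp z (tnth y 0) (tnth y 1) (tnth y 2).
  by rewrite !yz jac_X -/(jact y) hJy comp_mpolyC => <-.
rewrite /jact !tnth_mktuple !jac_comp -!/(jact _) rmorphM /= => e.
by rewrite hJy !comp_mpolyC -hJy mulrAC e mul1r.
Qed.

Lemma lin_meval0 (w : 3.-tuple P) i : tnth w i \is 1.-homog -> (tnth w i).@[fun=> 0] = 0.
Proof. by move=> h; rewrite meval0E; apply: (dhomog_nemf_coeff h); rewrite /= mdeg0. Qed.

Lemma core_conj Om t N : core Om t N -> core (Om \mPo z) (conjt t) N.
Proof.
case=> fib int J0 hJ N0 eqOm [c c0 cube]; split=> //.
(* If [conjt t] agrees at [v] and at 0, then [t] agrees at [z(v)] and at [z(0) = 0]; so [z(v) = 0],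
   and applying [y] gives [v = 0]. *)
- move=> v ev; have zv0 : forall i, (tnth z i).@[v] = 0.
    apply: fib => j; have tE w : (tnth t j).@[fun i => (tnth z i).@[w]] =
        (tnth z j).@[fun i => (tnth (conjt t) i).@[w]].
      rewrite -!comp_mpoly_meval comp_conjt; congr (_.@[_]).
      by rewrite zy tnth_comp.
    rewrite tE (meval_eq _ ev) -meval0E.
    have -> : (tnth t j).@[fun=> 0] = (tnth t j).@[fun i => (tnth z i).@[fun=> 0]].
      by apply: meval_eq => i; rewrite lin_meval0.
    by rewrite tE; apply: meval_eq => i; rewrite meval0E.
  move=> i; rewrite -(mevalXU v i) -yz comp_mpoly_meval (meval_eq _ zv0).
  exact: lin_meval0.
- move=> u; have [F [hF mF Fu]] := int (u \mPo y).
  exists (map_poly (comp_mpoly z) F); split.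
  + move=> i; have [b eb] := hF i; exists (b \mPo z).
    by rewrite coef_map /= eb comp_conjt comp_zy.
  + exact: monic_map.
  by rewrite -[u in X in X = _]comp_yz horner_map /= Fu comp_mpoly0.
- rewrite jact_conjt; apply: contraNneq J0 => e.
  by rewrite -[jact t]comp_zy e comp_mpoly0.
- by rewrite jact_conjt; apply: comp_homog.
- by rewrite jact_conjt comp_conjt comp_zy -comp_mpolyZ eqOm comp_mpolyZ rmorphM.
by exists c => //; rewrite jact_conjt -!rmorphXn /= cube comp_mpolyZ.
Qed.

End Conjugation.

Lemma core_comp_neq0 Om t N : Om != 0 -> core Om t N -> Om \mPo t != 0.
Proof.
move=> Om0 h; apply/eqP => e; have := core_comp h; rewrite e scaler0 => /esym/eqP.
by rewrite scaler_eq0 (negPf (natK_neq0 2)) mulf_eq0 (negPf (core_jact0 h)) (negPf Om0).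
Qed.

Section Split.
Variables (c : K) (s : seq P) (Om : P) (t : 3.-tuple P) (N : nat).
Hypotheses (hs : forall l, l \in s -> l \is 1.-homog /\ l != 0) (c0 : c != 0).
Hypotheses (OmE : Om = c *: \prod_(l <- s) l) (h : core Om t N).

Lemma prod_flatten_nseq k : \prod_(l <- flatten (nseq k s)) l = (\prod_(l <- s) l) ^+ k.
Proof. by elim: k => [|k IH]; rewrite ?big_nil //= big_cat IH exprS. Qed.

Lemma flatten_nseq_sub k : {subset flatten (nseq k s) <= s}.
Proof. by move=> l /flattenP[s']; rewrite mem_nseq => /andP[_ /eqP ->]. Qed.

Lemma dvd_pow_split a b e k : e != 0 -> a * b = e *: Om ^+ k ->
  exists c' s', [/\ c' != 0, {subset s' <= s} & a = c' *: \prod_(l <- s') l].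
Proof.
move=> e0; rewrite OmE exprZn scalerA -prod_flatten_nseq => eq.
have [||c' [s' [c'0 sub ->]]] := dvd_prod_linear _ _ eq.
- by move=> l /flatten_nseq_sub; apply: hs.
- by rewrite mulf_neq0 ?expf_neq0.
by exists c', s'; split=> // l /sub /flatten_nseq_sub.
Qed.

Lemma jact_split :
  exists c' s', [/\ c' != 0, {subset s' <= s} & jact t = c' *: \prod_(l <- s') l].
Proof.
by have [e e0 eJ] := core_cube h; apply: (@dvd_pow_split _ (jact t ^+ 2) e N).
Qed.

(** Since [Om(t) = 3 / (N + 3) J Om] and [J ^ 3 = e Om ^ N], the cube of [Om(t)] is a multiple of
    [Om ^ (N + 3)] by a nonzero scalar. *)
Lemma dvd_comp_split a b : a * b = Om \mPo t ->
  exists c' s', [/\ c' != 0, {subset s' <= s} & a = c' *: \prod_(l <- s') l].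
Proof.
move=> eab; have [e e0 eJ] := core_cube h.
apply: (@dvd_pow_split _ (b * (a * b) ^+ 2) ((3%:R / (N + 3)%:R) ^+ 3 * e) (N + 3)).
  by rewrite mulf_neq0 ?expf_neq0 // mulf_neq0 ?invr_eq0 ?addn3 ?natK_neq0.
rewrite mulrA -exprS eab.
have -> : Om \mPo t = (3%:R / (N + 3)%:R) *: (jact t * Om).
  have n0 : ((N + 3)%:R : K) != 0 by rewrite addn3 natK_neq0.
  apply: (scalerI n0); rewrite (core_comp h) scalerA mulrCA divff // mulr1 //.
by rewrite exprZn [(jact t * Om) ^+ 3]exprMn eJ -scalerAl scalerA -exprD.
Qed.

End Split.

Section Coordinates.

Lemma pt0 (x y z : K) : pt x y z 0 = x. Proof. by []. Qed.
Lemma pt1 (x y z : K) : pt x y z 1 = y. Proof. by []. Qed.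
Lemma pt2 (x y z : K) : pt x y z 2 = z. Proof. by []. Qed.
Lemma mk3_0 (a b e : P) : tnth [tuple a; b; e] 0 = a. Proof. by []. Qed.
Lemma mk3_1 (a b e : P) : tnth [tuple a; b; e] 1 = b. Proof. by []. Qed.
Lemma mk3_2 (a b e : P) : tnth [tuple a; b; e] 2 = e. Proof. by []. Qed.

Lemma meval_third_indep (p : P) (x y z z' : K) :
  d3 p = 0 -> p.@[pt x y z] = p.@[pt x y z'].
Proof.
move=> dp; pose r : 3.-tuple P := [tuple x%:MP; y%:MP; Z].
have : p \mPo r = ((p \mPo r)@_0)%:MP.
  apply: (const_of_mderiv0 char0) => j; rewrite mderiv_comp3 dp comp_mpoly0 mul0r.
  by rewrite mk3_0 mk3_1 !mderivC !mulr0 !addr0.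
have ev w : (p \mPo r).@[pt 0 0 w] = p.@[pt x y w].
  rewrite comp_mpoly_meval; apply: meval_eq; apply: ord3P.
  - by rewrite mk3_0 mevalC.
  - by rewrite mk3_1 mevalC.
  by rewrite mk3_2 mevalXU.
by move=> e; rewrite -!ev e !mevalC.
Qed.

Lemma meval_third_affine (p : P) (c x y z : K) :
  d3 p = c%:MP -> p.@[pt x y z] = c * z + p.@[pt x y 0].
Proof.
move=> dp; have : d3 (p - c *: Z) = 0.
  by rewrite /d3 mderivB mderivZ mderivXU -/(d3 p) dp -mul_mpolyC mulr1 subrr.
move=> /(meval_third_indep x y z 0); rewrite !mevalB !mevalZ !mevalXU !pt2.
by rewrite mulr0 subr0 => <-; rewrite addrC subrK.
Qed.

Lemma pt0E : pt 0 0 0 =1 fun=> 0.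
Proof. by apply: ord3P. Qed.

Lemma d3_prod s : (forall l, l \in s -> d3 l = 0) -> d3 (\prod_(l <- s) l) = 0.
Proof.
elim: s => [|l s IH] h; first by rewrite big_nil /d3 -mpolyC1 mderivC.
rewrite big_cons /d3 mderivM -!/(d3 _) h ?mem_head // IH ?mul0r ?mulr0 ?addr0 // => k ks.
by apply: h; rewrite inE ks orbT.
Qed.

End Coordinates.

End Core.

(** * Exclusion of the normal forms of [Om] *)

Section NormalForms.
Variable K : fieldType.
Hypothesis char0 : forall k, (k%:R == 0 :> K) = (k == 0)%N.
Local Notation P := {mpoly K[3]}.
Local Notation X := ('X_0 : P).
Local Notation Y := ('X_1 : P).
Local Notation Z := ('X_2 : P).
Implicit Types (l : P) (t : 3.-tuple P) (s : seq P).

Lemma mpolyXU_neq0 i : ('X_i : P) != 0.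
Proof. by rewrite -msupp_eq0 msuppX. Qed.

Lemma coord_linear i : ('X_i : P) \is 1.-homog /\ ('X_i : P) != 0.
Proof. by rewrite homogX mpolyXU_neq0. Qed.

Lemma natr_injK (a b : nat) : a%:R = b%:R :> K -> a = b.
Proof.
wlog le : a b / (a <= b)%N => [wl e|].
  by case/orP: (leq_total a b) => /wl; [apply | move=> ->].
by move=> /eqP; rewrite eq_sym -subr_eq0 -natrB // char0 => /eqP; lia.
Qed.

Lemma jact_perm t (i j k : 'I_3) : i != j -> i != k -> j != k ->
  tnth t i * tnth t j * tnth t k = tnth t 0 * tnth t 1 * tnth t 2 /\
  (jac (tnth t i) (tnth t j) (tnth t k) = jact t \/
   jac (tnth t i) (tnth t j) (tnth t k) = - jact t).
Proof.
rewrite /jact; elim/ord3P: i; elim/ord3P: j; elim/ord3P: k => // _ _ _; split;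
  (try by ring).
all: by [left; rewrite /jac /pbr; ring | right; rewrite /jac /pbr; ring].
Qed.

(** Any other variable occurring in the monomial would make both values 0. *)
Lemma meval_axis (j : 'I_3) (m : 'X_{1..3}) :
  ('X_[m] : P).@[fun k => (k == j)%:R] != ('X_[m] : P).@[fun=> 0] ->
  (0 < m j)%N /\ ('X_[m] : P) = 'X_j ^+ m j.
Proof.
rewrite !mevalX => ne.
have m0 k : k != j -> m k = 0%N.
  move=> nkj; apply/eqP; apply: contraNT ne => mk; apply/eqP.
  by rewrite (bigD1 k) //= [RHS](bigD1 k) //= (negPf nkj) expr0n (negPf mk) !mul0r.
have mE : m = (U_(j) *+ m j)%MM.
  apply/mnmP => k; rewrite mulmnE mnm1E; have [->|nkj] := eqVneq j k.
    by rewrite mul1n.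
  by rewrite mul0n m0 // eq_sym.
split; last by rewrite {1}mE mpolyXn.
rewrite lt0n; apply: contraNneq ne => mj0; have -> : m = 0%MM by rewrite mE mj0 mulm0n.
by rewrite !big1 // => k _; rewrite mnm0E.
Qed.

(* Finiteness along the coordinate axes makes [t] a permutation of scaled powers of
   exponents [a], [b], [c]; then [a + b + c = N + 3 = 3 a b c]. *)
Lemma core_xyz c t N : c != 0 -> core (c *: (X * Y * Z)) t N -> False.
Proof.
move=> c0 h; pose s := [:: X; Y; Z].
have hs l : l \in s -> l \is 1.-homog /\ l != 0.
  by rewrite !inE => /or3P[] /eqP ->; apply: coord_linear.
have OmE : c *: (X * Y * Z) = c *: \prod_(l <- s) l.
  by rewrite !big_cons big_nil mulr1 mulrA.
have compE : (c *: (X * Y * Z)) \mPo t = c *: (tnth t 0 * tnth t 1 * tnth t 2).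
  by rewrite comp_mpolyZ !rmorphM /= !tnth_comp.
have mono i : exists k m, k != 0 /\ tnth t i = k *: 'X_[m].
  have [b eb] : exists b, tnth t i * b = (c *: (X * Y * Z)) \mPo t.
    rewrite compE -mul_mpolyC; elim/ord3P: i.
    - by exists (c%:MP * (tnth t 1 * tnth t 2)); ring.
    - by exists (c%:MP * (tnth t 0 * tnth t 2)); ring.
    by exists (c%:MP * (tnth t 0 * tnth t 1)); ring.
  have [k [s' [k0 sub ->]]] := dvd_comp_split char0 hs c0 OmE h eb.
  have [i0 [i1 [i2 ->]]] := prod_seq3 sub.
  exists k, (U_(0%R) *+ i0 + U_(1%R) *+ i1 + U_(2%R) *+ i2)%MM; split=> //.
  by rewrite !mpolyXD !mpolyXn.
(* The [j]-th unit point is not in the fiber of the origin, so some entry of [t] separates the two;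
   as a monomial it must be a power of ['X_j]. *)
have axis j : exists i k a, [/\ k != 0 & tnth t i = k *: 'X_j ^+ a.+1].
  pose v (i : 'I_3) : K := (i == j)%:R.
  have /existsP[i ne] : [exists i, (tnth t i).@[v] != (tnth t i)@_0].
    rewrite -negb_forall; apply/negP => /forallP e.
    have := core_fiber h (fun i => eqP (e i)) j; rewrite /v eqxx => /eqP.
    by rewrite oner_eq0.
  have [k [m [k0 e]]] := mono i; exists i, k, (m j).-1.
  move: ne; rewrite e -meval0E !mevalZ => ne.
  have [|mj mE] := @meval_axis j m; first by apply: contraNneq ne => ->.
  by rewrite prednK // mE.
have indep j j' i i' k k' a a' : j != j' -> k != 0 -> tnth t i = k *: 'X_j ^+ a.+1 ->
    tnth t i' = k' *: 'X_j' ^+ a'.+1 -> i != i'.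
  move=> njj k0 e e'; apply/eqP => ii; subst i'; have := e; rewrite e'.
  move=> /(congr1 (meval (fun r => (r == j)%:R))); rewrite !mevalZ !rmorphXn /= !mevalXU.
  rewrite eqxx eq_sym (negPf njj) expr0n mulr0 expr1n mulr1 => /eqP.
  by rewrite eq_sym (negPf k0).
have [i0 [k0 [a0 [k00 e0]]]] := axis 0.
have [i1 [k1 [a1 [k10 e1]]]] := axis 1.
have [i2 [k2 [a2 [k20 e2]]]] := axis 2.
have n01 : i0 != i1 by apply: (indep 0 1 _ _ _ _ _ _ _ k00 e0 e1).
have n02 : i0 != i2 by apply: (indep 0 2 _ _ _ _ _ _ _ k00 e0 e2).
have n12 : i1 != i2 by apply: (indep 1 2 _ _ _ _ _ _ _ k10 e1 e2).
have [prodE Jsign] := jact_perm t n01 n02 n12.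
have := core_comp h; rewrite compE -prodE => C3.
have jacE : jac (tnth t i0) (tnth t i1) (tnth t i2) =
    (k0 * k1 * k2 * (a0.+1 * a1.+1 * a2.+1)%:R) *: (X ^+ a0 * Y ^+ a1 * Z ^+ a2).
  rewrite e0 e1 e2 /jac /pbr /d1 /d2 /d3 !mderivZ !mderivXS !mderivXU /=.
  by rewrite -!mul_mpolyC !rmorphM /= !mpolyC_nat !natrM; ring.
pose sgn (b : bool) : K := (-1) ^+ b.
have [b Jb] : exists b, jact t = sgn b *: jac (tnth t i0) (tnth t i1) (tnth t i2).
  case: Jsign => ->; first by exists false; rewrite /sgn scale1r.
  by exists true; rewrite /sgn expr1 scaleN1r opprK.
have sgn0 : sgn b != 0 by rewrite signr_eq0.
have NE : N = (a0 + a1 + a2)%N.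
  apply: (dhomog_uniq (core_jact0 h) (core_homog h)).
  rewrite Jb jacE !rpredZ //; apply: dhomogM; first apply: dhomogM;
    by rewrite -[X in X.-homog]mul1n; apply: dhomogMn; apply: homogX.
have kk0 : k0 * k1 * k2 != 0 by rewrite !mulf_neq0.
(* At [(1, 1, 1)] all powers are 1 and only the numerical factors remain. The sign left by the
   permutation must be positive, since the other makes a sum of positive integers vanish in [K]. *)
have := congr1 (meval (fun=> 1)) C3.
rewrite Jb jacE e0 e1 e2 !(mevalZ, mevalM, rmorphXn) /= !mevalXU !expr1n !mulr1.
move=> E; have {E} : (N + 3)%:R = sgn b * (3 * (a0.+1 * a1.+1 * a2.+1))%:R.
  apply: (mulfI (mulf_neq0 kk0 c0)); transitivity ((N + 3)%:R * (c * (k0 * k1 * k2))).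
    by ring.
  by rewrite E [(3 * _)%:R]natrM; ring.
have N0 := core_pos h; rewrite /sgn; case: (b) => /=.
  rewrite expr1 mulN1r => /eqP; rewrite -addr_eq0 -natrD char0 addn3 => /eqP //.
rewrite mul1r => /natr_injK; rewrite NE in N0 *; nia.
Qed.

Section Plane.
Variables (c : K) (s : seq P) (t : 3.-tuple P) (N : nat) (b0 b1 : P).
Local Notation Om := (c *: \prod_(l <- s) l).
Hypotheses (hs : forall l, l \in s -> l \is 1.-homog /\ l != 0).
Hypotheses (c0 : c != 0) (ds : forall l, l \in s -> d3 l = 0) (h : core Om t N).
Hypotheses (e0 : tnth t 0 * b0 = Om \mPo t) (e1 : tnth t 1 * b1 = Om \mPo t).

(** Here [Om] involves only [X] and [Y], hence so do [J], [t 0] and [t 1] as products of its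
    factors. So [J] is the product of their minor [D] and [d3 (t 2)]; the latter turns out to be
    constant, and the degree of [D] gives the count. *)
Lemma core_plane : exists d k0 s0 k1 s1,
  [/\ d != 0, d3 (tnth t 2) = d%:MP,
      [/\ k0 != 0, {subset s0 <= s} & tnth t 0 = k0 *: \prod_(l <- s0) l],
      [/\ k1 != 0, {subset s1 <= s} & tnth t 1 = k1 *: \prod_(l <- s1) l] &
      (size s0 + size s1 = N + 2)%N].
Proof.
have [k0 [s0 [k00 sub0 E0]]] := dvd_comp_split char0 hs c0 erefl h e0.
have [k1 [s1 [k10 sub1 E1]]] := dvd_comp_split char0 hs c0 erefl h e1.
have [kJ [sJ [kJ0 subJ EJ]]] := jact_split hs c0 erefl h.
have d3s k s' : {subset s' <= s} -> d3 (k *: \prod_(l <- s') l) = 0.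
  by move=> sub; rewrite /d3 mderivZ -/(d3 _) d3_prod ?scaler0 // => l /sub /ds.
have d30 : d3 (tnth t 0) = 0 by rewrite E0 d3s.
have d31 : d3 (tnth t 1) = 0 by rewrite E1 d3s.
have d3J : d3 (jact t) = 0 by rewrite EJ d3s.
pose D := d1 (tnth t 0) * d2 (tnth t 1) - d2 (tnth t 0) * d1 (tnth t 1).
have JE : jact t = D * d3 (tnth t 2).
  by rewrite /jact /jac /pbr d30 d31 /D; ring.
have [D0 S0] : D != 0 /\ d3 (tnth t 2) != 0.
  by apply/andP; rewrite -negb_or -mulf_eq0 -JE (core_jact0 h).
have d3D : d3 D = 0.
  rewrite /D /d3 mderivB !mderivM /d1 /d2 !(mderiv_comm _ 2) -!/(d3 _) d30 d31.
  by rewrite !mderiv0; ring.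
have d3S : d3 (d3 (tnth t 2)) = 0.
  apply: (mulfI D0); rewrite mulr0; move: d3J; rewrite JE.
  by rewrite {1}/d3 mderivM -!/(d3 _) d3D mul0r add0r.
(* Otherwise [t] would be constant on the [Z]-axis: [d3 (t 2)] does not depend on [Z], so it would
   vanish on the whole axis. Then [(0, 0, 1)] would lie in the fiber of the origin. *)
have Sc : (d3 (tnth t 2))@_0 != 0.
  apply/eqP => S00; have := @core_fiber _ _ _ _ h (pt 0 0 1) _ 2.
  rewrite pt2 => H; suff /eqP : 1 = 0 :> K by rewrite oner_eq0.
  apply: H; have ev0 p : p.@[pt 0 0 0] = p@_0.
    by rewrite -meval0E; apply: meval_eq; apply: pt0E.
  apply: ord3P; rewrite -ev0.
  - exact: (meval_third_indep char0).
  - exact: (meval_third_indep char0).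
  pose ax : 3.-tuple P := [tuple 0; 0; Z].
  have dax p : mderiv 2 (p \mPo ax) = d3 p \mPo ax.
    by rewrite mderiv_comp3 mk3_0 mk3_1 mk3_2 !mderiv0 mderivXU eqxx !mulr0 !add0r mulr1.
  have dax' p j : j != 2 -> mderiv j (p \mPo ax) = 0.
    move=> nj; rewrite mderiv_comp3 mk3_0 mk3_1 mk3_2 !mderiv0 mderivXU (negPf nj).
    by rewrite !mulr0 !add0r.
  have cst p : d3 p \mPo ax = 0 -> p \mPo ax = ((p \mPo ax)@_0)%:MP.
    move=> dp; apply: (const_of_mderiv0 char0) => j.
    by have [->|/dax' //] := eqVneq j 2; rewrite dax.
  have evax p w : (p \mPo ax).@[pt 0 0 w] = p.@[pt 0 0 w].
    rewrite comp_mpoly_meval; apply: meval_eq; apply: ord3P.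
    - by rewrite mk3_0 meval0.
    - by rewrite mk3_1 meval0.
    by rewrite mk3_2 mevalXU.
  rewrite -(evax _ 1) -(evax _ 0) (cst (tnth t 2)) ?mevalC // (cst (d3 (tnth t 2))).
    by rewrite -ev0 evax ev0 S00.
  by rewrite d3S comp_mpoly0.
have hDS : D * d3 (tnth t 2) \is N.-homog by rewrite -JE (core_homog h).
have [hD SE] := homog_mul_unit D0 Sc hDS.
exists (d3 (tnth t 2))@_0, k0, s0, k1, s1; split=> //.
have hom k s' : {subset s' <= s} -> k *: \prod_(l <- s') l \is (size s').-homog.
  by move=> sub; rewrite rpredZ // prod_linear_homog // => l /sub /hs[].
have h0 : tnth t 0 \is (size s0).-homog by rewrite E0 hom.
have h1 : tnth t 1 \is (size s1).-homog by rewrite E1 hom.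
have nconst i n : tnth t i \is n.-homog -> jact t != 0 -> (i != 2) -> (0 < n)%N.
  case: n => // /homog0_const ec; move=> /negP J0 ni; case: J0; apply/eqP; rewrite /jact.
  elim/ord3P: i ni ec => // _ ->; first by rewrite jac_const.
  by rewrite jacC jac_const.
have := nconst 0 _ h0 (core_jact0 h) isT; have := nconst 1 _ h1 (core_jact0 h) isT.
case: (size s0) h0 => // n0 h0; case: (size s1) h1 => // n1 h1 _ _.
have : D \is (n0 + n1).-homog.
  by rewrite /D; apply: rpredB; apply: dhomogM; apply: mderiv_homog.
by move=> /(dhomog_uniq D0 hD) ->; rewrite addSn addnS addn2.
Qed.

End Plane.

Lemma homog_uniq (p : P) d e : p != 0 -> p \is d.-homog -> p \is e.-homog -> d = e.
Proof. exact: dhomog_uniq. Qed.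

Lemma homogXn i n : ('X_i ^+ n : P) \is n.-homog.
Proof. by rewrite -[X in X.-homog]mul1n; apply: dhomogMn; apply: homogX. Qed.

Lemma homog_sum_eq (p q : P) i j k : p != 0 -> q != 0 -> p + q != 0 ->
  p \is i.-homog -> q \is j.-homog -> p + q \is k.-homog -> i = k /\ j = k.
Proof.
move=> p0 q0 pq0 hp hq hpq; have [ij|nij] := eqVneq i j.
  by have := dhomog_uniq pq0 (rpredD hp (eq_ind_r (fun e => q \is e.-homog) hq ij)) hpq; lia.
have hit (r r' : P) e e' : e != e' -> r != 0 -> r \is e.-homog -> r' \is e'.-homog ->
    r + r' \is k.-homog -> e = k.
  move=> ne r0 hr hr' hrr; have lr := mlead_supp r0.
  have dl := dhomog_mf hr lr; rewrite -dl /=; apply: (dhomog_mf hrr).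
  rewrite mcoeff_msupp mcoeffD (dhomog_nemf_coeff hr') ?addr0 -?mcoeff_msupp //.
  by rewrite dl.
by split; [apply: (hit p q i j) | apply: (hit q p j i); rewrite // 1?eq_sym // addrC].
Qed.

(** The third factor of [Om(t)] has degree 1, by comparing the two degree counts. It is the sum of
    nonzero multiples of the homogeneous [t 0] and [t 1], so these have degree 1 too and [N = 0]. *)
Lemma core_plane_generic c al be t N : c != 0 -> al != 0 -> be != 0 ->
  core (c *: (X * Y * (al *: X + be *: Y))) t N -> False.
Proof.
move=> c0 al0 be0; pose l := al *: X + be *: Y; rewrite -/l; pose s := [:: X; Y; l].
have hl : l \is 1.-homog by apply: rpredD; rewrite rpredZ ?homogX.
have l0 : l != 0.
  apply: contraNneq al0 => /(congr1 (meval (pt 1 0 0))).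
  by rewrite mevalD !mevalZ !mevalXU pt0 pt1 mulr0 mulr1 addr0 meval0 => ->.
have hs r : r \in s -> r \is 1.-homog /\ r != 0.
  by rewrite !inE => /or3P[] /eqP -> //; apply: coord_linear.
have ds r : r \in s -> d3 r = 0.
  rewrite !inE /d3 => /or3P[] /eqP ->; rewrite ?mderivXU //.
  by rewrite mderivD !mderivZ !mderivXU !scaler0 addr0.
have -> : c *: (X * Y * l) = c *: \prod_(r <- s) r.
  by rewrite !big_cons big_nil mulr1 mulrA.
move=> h; have lt : l \mPo t = al *: tnth t 0 + be *: tnth t 1.
  by rewrite comp_mpolyD !comp_mpolyZ !tnth_comp.
have compE : (c *: \prod_(r <- s) r) \mPo t =
    c%:MP * (tnth t 0 * tnth t 1 * (l \mPo t)).
  by rewrite !big_cons big_nil comp_mpolyZ mulr1 !rmorphM /= !tnth_comp mul_mpolyC mulrA.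
have e0 : tnth t 0 * (c%:MP * (tnth t 1 * (l \mPo t))) = (c *: \prod_(r <- s) r) \mPo t.
  by rewrite compE; ring.
have e1 : tnth t 1 * (c%:MP * (tnth t 0 * (l \mPo t))) = (c *: \prod_(r <- s) r) \mPo t.
  by rewrite compE; ring.
have e2 : (l \mPo t) * (c%:MP * (tnth t 0 * tnth t 1)) = (c *: \prod_(r <- s) r) \mPo t.
  by rewrite compE; ring.
have [d [k0 [s0 [k1 [s1 [_ _ [k00 sub0 E0] [k10 sub1 E1] sz]]]]]] :=
  core_plane hs c0 ds h e0 e1.
have [k2 [s2 [k20 sub2 E2]]] := dvd_comp_split char0 hs c0 erefl h e2.
have prod0 (s' : seq P) : {subset s' <= s} -> \prod_(r <- s') r != 0.
  by move=> sub; rewrite prodf_seq_neq0; apply/allP => r /sub /hs[].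
have hom k s' : {subset s' <= s} -> k *: \prod_(r <- s') r \is (size s').-homog.
  by move=> sub; rewrite rpredZ // prod_linear_homog // => r /sub /hs[].
have nz k s' : k != 0 -> {subset s' <= s} -> k *: \prod_(r <- s') r != 0.
  by move=> k' sub; rewrite scaler_eq0 negb_or k' prod0.
have h0 : tnth t 0 \is (size s0).-homog by rewrite E0 hom.
have h1 : tnth t 1 \is (size s1).-homog by rewrite E1 hom.
have h2 : l \mPo t \is (size s2).-homog by rewrite E2 hom.
have Om0 : c *: \prod_(r <- s) r != 0 by apply: nz.
have szN : (size s0 + size s1 + size s2 = N + 3)%N.
  apply: (homog_uniq (core_comp_neq0 char0 Om0 h)).
    by rewrite compE mul_mpolyC rpredZ //; apply: dhomogM => //; apply: dhomogM.
  have n0 : ((N + 3)%:R : K) != 0 by rewrite addn3 char0.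
  have -> : (c *: \prod_(r <- s) r) \mPo t =
     (N + 3)%:R^-1 *: (3%:R *: (jact t * (c *: \prod_(r <- s) r))).
    by rewrite -(core_comp h) scalerA mulVf // scale1r.
  by rewrite !rpredZ //; apply: dhomogM; [apply: core_homog h | apply: hom].
have [||||||i0 i1] := @homog_sum_eq (al *: tnth t 0) (be *: tnth t 1)
  (size s0) (size s1) (size s2).
- by rewrite scaler_eq0 negb_or al0 E0 nz.
- by rewrite scaler_eq0 negb_or be0 E1 nz.
- by rewrite -lt E2 nz.
- by rewrite rpredZ.
- by rewrite rpredZ.
- by rewrite -lt.
by move: (core_pos h) szN sz i0 i1; clear; lia.
Qed.

(** The degree counts force [t 0] to be a scalar times [X] or [Y]. If [t 1] is divisible by the same
    variable, both vanish on a plane and the fiber of the origin is too large. If not, [t 1] is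
    constant and [J = 0], or [J] is a scalar times a power of the other variable and fails to vanish
    somewhere on [Om = 0]. *)
Lemma core_square c t N : c != 0 -> core (c *: (X * X * Y)) t N -> False.
Proof.
move=> c0; pose s := [:: X; X; Y].
have hs r : r \in s -> r \is 1.-homog /\ r != 0.
  by rewrite !inE => /or3P[] /eqP ->; apply: coord_linear.
have ds r : r \in s -> d3 r = 0.
  by rewrite !inE /d3 => /or3P[] /eqP ->; rewrite ?mderivXU.
have sE : X * X * Y = \prod_(r <- s) r by rewrite !big_cons big_nil mulr1 mulrA.
rewrite sE => h.
have compE : (c *: \prod_(r <- s) r) \mPo t = c%:MP * (tnth t 0 * tnth t 0 * tnth t 1).
  by rewrite !big_cons big_nil comp_mpolyZ mulr1 !rmorphM /= !tnth_comp mul_mpolyC mulrA.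
have e0 : tnth t 0 * (c%:MP * (tnth t 0 * tnth t 1)) = (c *: \prod_(r <- s) r) \mPo t.
  by rewrite compE; ring.
have e1 : tnth t 1 * (c%:MP * (tnth t 0 * tnth t 0)) = (c *: \prod_(r <- s) r) \mPo t.
  by rewrite compE; ring.
have [d [k0 [s0 [k1 [s1 [d0 dE [k00 sub0 E0] [k10 sub1 E1] sz]]]]]] :=
  core_plane hs c0 ds h e0 e1.
have prod0 (s' : seq P) : {subset s' <= s} -> \prod_(r <- s') r != 0.
  by move=> sub; rewrite prodf_seq_neq0; apply/allP => r /sub /hs[].
have hom k s' : {subset s' <= s} -> k *: \prod_(r <- s') r \is (size s').-homog.
  by move=> sub; rewrite rpredZ // prod_linear_homog // => r /sub /hs[].
have Om0 : c *: \prod_(r <- s) r != 0 by rewrite scaler_eq0 negb_or c0 prod0.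
have szN : (size s0 + size s0 + size s1 = N + 3)%N.
  apply: (homog_uniq (core_comp_neq0 char0 Om0 h)).
    rewrite compE mul_mpolyC rpredZ //; apply: dhomogM; last by rewrite E1 hom.
    by apply: dhomogM; rewrite E0 hom.
  have n0 : ((N + 3)%:R : K) != 0 by rewrite addn3 char0.
  have -> : (c *: \prod_(r <- s) r) \mPo t =
     (N + 3)%:R^-1 *: (3%:R *: (jact t * (c *: \prod_(r <- s) r))).
    by rewrite -(core_comp h) scalerA mulVf // scale1r.
  by rewrite !rpredZ //; apply: dhomogM; [apply: core_homog h | apply: hom].
have sz0 : size s0 = 1%N by move: sz szN; clear; lia.
case: s0 sz0 sub0 E0 {sz szN} => [//|r [|//]] _ sub0; rewrite big_seq1 => E0.
have [a [a' [b E1']]] := prod_seq3 sub1; rewrite {}E1' -exprD in E1.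
move: (a + a')%N E1 => {a a'} a E1.
have Jvan v : (X * X * Y).@[v] = 0 -> (jact t).@[v] = 0.
  move=> ev; have [e _ /(congr1 (meval v))] := core_cube h.
  rewrite mevalZ !rmorphXn /= mevalZ -sE ev mulr0 expr0n.
  by rewrite (gtn_eqF (core_pos h)) mulr0 => /eqP; rewrite expf_eq0 => /eqP.
have ev0 p : p.@[pt 0 0 0] = p@_0.
  by rewrite -meval0E; apply: meval_eq; apply: pt0E.
(* [t 2] is affine in [Z] with slope [d != 0], so its value can be matched above any [(x, y)]. *)
have third x y : exists z, (tnth t 2).@[pt x y z] = (tnth t 2)@_0.
  exists (((tnth t 2)@_0 - (tnth t 2).@[pt x y 0]) / d).
  by rewrite (meval_third_affine char0 _ _ _ dE) mulrC divfK // subrK.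
have JE : jact t = d%:MP * (d1 (tnth t 0) * d2 (tnth t 1) - d2 (tnth t 0) * d1 (tnth t 1)).
  have d30 : d3 (tnth t 0) = 0.
    by rewrite E0 /d3 mderivZ -/(d3 _) ds ?scaler0 // sub0 ?mem_head.
  have d31 : d3 (tnth t 1) = 0.
    by rewrite E1 /d3 mderivZ mderivM; case: (a) => [|?]; case: (b) => [|?];
       rewrite ?expr0 -?mpolyC1 ?mderivC ?mderivXS ?mderivXU !(mulr0, mul0r, addr0) scaler0.
  by rewrite /jact /jac /pbr d30 d31 dE; ring.
have : r \in s by apply: sub0; apply: mem_head.
rewrite !inE orbA orbb => /orP[] /eqP rE; rewrite {}rE in E0.
- case: a E1 => [|a] E1.
    case: b E1 => [|b] E1.
      have := core_jact0 h; rewrite JE E1 /d1 /d2 !mderivZ !expr0 mulr1 -mpolyC1 !mderivC.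
      by rewrite !scaler0 !mulr0 subrr mulr0 eqxx.
    have := Jvan (pt 0 1 0); rewrite !mevalM !mevalXU pt0 pt1 !mul0r => /(_ erefl) /eqP.
    rewrite JE E0 E1 expr0 mul1r /d1 /d2 !mderivZ !mderivXS !mderivXU /=.
    rewrite !(mulr0, mulr1, scaler0, mul0r, subr0) !(mevalM, mevalZ, mevalC, rmorphXn) /=.
    rewrite mevalXU pt1 expr1n -mpolyC_nat mevalC !mulr1 !mulf_eq0.
    by rewrite (negPf d0) (negPf k00) (negPf k10) char0.
  have [z ez] := third 0 1; have := core_fiber h (v := pt 0 1 z) _ 1; rewrite pt1 => H.
  suff /eqP : 1 = 0 :> K by rewrite oner_eq0.
  apply: H; apply: ord3P => //; rewrite -ev0 ?E0 ?E1 !mevalZ ?mevalM ?rmorphXn /= !mevalXU.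
    by rewrite !pt0.
  by rewrite !pt0 !expr0n !mul0r.
case: b E1 => [|b] E1.
  case: a E1 => [|a] E1.
    have := core_jact0 h; rewrite JE E1 /d1 /d2 !mderivZ !expr0 mulr1 -mpolyC1 !mderivC.
    by rewrite !scaler0 !mulr0 subrr mulr0 eqxx.
  have := Jvan (pt 1 0 0); rewrite !mevalM !mevalXU pt0 pt1 !mulr0 => /(_ erefl) /eqP.
  rewrite JE E0 E1 expr0 mulr1 /d1 /d2 !mderivZ !mderivXS !mderivXU /=.
  rewrite !(mulr0, mulr1, scaler0, mul0r, sub0r).
  rewrite !(mevalM, mevalN, mevalZ, mevalC, rmorphXn) /=.
  rewrite mevalXU pt0 expr1n -mpolyC_nat mevalC !mulr1 mulrN oppr_eq0 !mulf_eq0.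
  by rewrite (negPf d0) (negPf k00) (negPf k10) char0.
have [z ez] := third 1 0; have := core_fiber h (v := pt 1 0 z) _ 0; rewrite pt0 => H.
suff /eqP : 1 = 0 :> K by rewrite oner_eq0.
apply: H; apply: ord3P => //; rewrite -ev0 ?E0 ?E1 !mevalZ ?mevalM ?rmorphXn /= !mevalXU.
  by rewrite !pt1.
by rewrite !pt1 !expr0n !mulr0.
Qed.

(* Here [t 0] is a scaled power of [X], and the Jacobian of [t 1], [t 2] in [Y, Z]
   vanishes on [X = 0], where [Y] and [Z] are still integral over their restrictions. *)
Lemma core_cubic c t N : c != 0 -> core (c *: X ^+ 3) t N -> False.
Proof.
move=> c0; pose s := [:: X; X; X].
have hs r : r \in s -> r \is 1.-homog /\ r != 0.
  by rewrite !inE => /or3P[] /eqP ->; apply: coord_linear.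
have sE : X ^+ 3 = \prod_(r <- s) r by rewrite !big_cons big_nil mulr1 exprSr mulrA.
rewrite sE => h.
have compE : (c *: \prod_(r <- s) r) \mPo t = c *: tnth t 0 ^+ 3.
  by rewrite -sE comp_mpolyZ rmorphXn /= tnth_comp.
have e0 : tnth t 0 * (c *: tnth t 0 ^+ 2) = (c *: \prod_(r <- s) r) \mPo t.
  by rewrite compE -scalerAr -exprS.
have pw s' : {subset s' <= s} -> \prod_(r <- s') r = X ^+ size s'.
  elim: s' => [|r s' IH] sub; first by rewrite big_nil.
  rewrite big_cons IH /= => [|l ls]; last by apply: sub; rewrite inE ls orbT.
  by have := sub r (mem_head _ _); rewrite !inE !orbb => /eqP ->; rewrite exprS.
have [k [s0 [k0 /pw -> E0]]] := dvd_comp_split char0 hs c0 erefl h e0.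
have [kJ [sJ [kJ0 /pw -> EJ]]] := jact_split hs c0 erefl h.
have X0 := mpolyXU_neq0 0.
have JN : jact t = kJ *: X ^+ N.
  rewrite EJ; congr (_ *: _ ^+ _); apply: (homog_uniq (core_jact0 h)) (core_homog h).
  by rewrite EJ rpredZ // homogXn.
move: (size s0) E0 => a E0 {EJ}.
have aE : (a * 3 = N + 3)%N.
  have := core_comp h; rewrite compE E0 JN exprZn -sE => E.
  have nz n : X ^+ n != 0 by rewrite expf_neq0.
  have nz1 : (N + 3)%:R *: (c *: (k ^+ 3 *: (X ^+ a) ^+ 3)) != 0.
    by rewrite !scaler_eq0 !negb_or addn3 char0 c0 !expf_neq0.
  apply: (homog_uniq nz1); first by rewrite !rpredZ // -exprM homogXn.
  by rewrite E !rpredZ //; apply: dhomogM; rewrite rpredZ ?homogXn.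
(* From [3 a = N + 3 > 3] follows [a >= 2]; this makes the minor [m] below divisible by [X]. *)
have [N0 [b aS]] : (0 < N)%N /\ exists b, a = b.+2.
  have N0 := core_pos h; split=> //; exists a.-2; move: N0 aE; clear; lia.
subst a; pose m := d2 (tnth t 1) * d3 (tnth t 2) - d3 (tnth t 1) * d2 (tnth t 2).
have mE : m = (kJ / (k * b.+2%:R)) *: X ^+ b.+1 * X ^+ b.+1.
  have : jact t = d1 (tnth t 0) * m.
    have d20 : d2 (tnth t 0) = 0 by rewrite E0 /d2 mderivZ mderivXS mderivXU mulr0 scaler0.
    have d30 : d3 (tnth t 0) = 0 by rewrite E0 /d3 mderivZ mderivXS mderivXU mulr0 scaler0.
    by rewrite /jact /jac /pbr d20 d30 /m; ring.
  rewrite JN E0 /d1 mderivZ mderivXS mderivXU mulr1 => E.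
  have NE : N = (b.+1 + b.+1 + b.+1)%N by move: aE; clear; lia.
  have q0 : (k * b.+2%:R) *: X ^+ b.+1 != 0.
    by rewrite scaler_eq0 negb_or mulf_neq0 ?expf_neq0 ?char0.
  apply: (mulfI q0); transitivity (kJ *: X ^+ N).
    by rewrite E -!mul_mpolyC rmorphM /= mpolyC_nat; ring.
  have e : k * b.+2%:R * (kJ / (k * b.+2%:R)) = kJ.
    by rewrite mulrCA divff ?mulr1 // mulf_neq0 ?char0.
  move: (kJ / _) e => r <-; rewrite NE -!mul_mpolyC rmorphM /= !exprD.
  by move: (X ^+ b.+1) => x; ring.
(* Restriction to the plane [X = 0], where [t 0] and [m] vanish. *)
pose R : 3.-tuple P := [tuple 0; Y; Z].
have dR j p : j != 0 -> mderiv j (p \mPo R) = mderiv j p \mPo R.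
  move=> nj; rewrite mderiv_comp3 mk3_0 mk3_1 mk3_2 mderiv0 !mderivXU.
  by elim/ord3P: j nj => // _ /=; rewrite !(mulr0, mulr1, add0r, addr0).
have mR : m \mPo R = 0.
  by rewrite mE rmorphM /= rmorphXn /= tnth_comp mk3_0 expr0n mulr0.
pose tR : 3.-tuple P := [tuple tnth t i \mPo R | i < 3].
(* Restricting a monic equation keeps it monic, hence nonzero, so the restricted [t 1] and [t 2]
   still span the gradients of [Y] and [Z] up to nonzero factors. Their Jacobian [m] could then not
   vanish on the plane. *)
have span j : j != 0 -> exists q (B : 'I_3 -> P), q != 0 /\ forall i, i != 0 ->
    q * (i == j)%:R =
    B 1 * (mderiv i (tnth t 1) \mPo R) + B 2 * (mderiv i (tnth t 2) \mPo R).
  move=> nj; have [F [hF mF Fu]] := core_integral h 'X_j.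
  have hFR : over_image tR (map_poly (comp_mpoly R) F).
    move=> i; have [b' eb] := hF i; exists b'.
    by rewrite coef_map /= eb comp_mpolyA.
  have FR0 : map_poly (comp_mpoly R) F != 0 by rewrite monic_neq0 // monic_map.
  have XR : 'X_j \mPo R = 'X_j by rewrite tnth_comp; elim/ord3P: j nj {Fu}.
  have FuR : (map_poly (comp_mpoly R) F).['X_j] = 0.
    by rewrite -XR horner_map /= Fu comp_mpoly0.
  have [q [B [q0 eB]]] := algebraic_mderiv_span char0 hFR FR0 FuR.
  exists q, B; split=> // i ni; have := eB i; rewrite mderivXU sum_ord3 !tnth_mktuple.
  have -> : tnth t 0 \mPo R = 0.
    by rewrite E0 comp_mpolyZ rmorphXn /= tnth_comp mk3_0 expr0n scaler0.
  by rewrite mderiv0 mulr0 add0r !dR.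
have [q1 [B [q10 eB]]] := span 1 isT; have [q2 [C [q20 eC]]] := span 2 isT.
have /eqP : q1 * q2 = (B 1 * C 2 - B 2 * C 1) * (m \mPo R).
  have EB1 := eB 1 isT; have EB2 := eB 2 isT; have EC1 := eC 1 isT; have EC2 := eC 2 isT.
  rewrite /= !mulr1 !mulr0 in EB1 EB2 EC1 EC2.
  transitivity (q1 * q2 - 0 * 0); first by rewrite mul0r subr0.
  rewrite {1}EB1 {1}EC2 {1}EB2 {1}EC1.
  by rewrite /m rmorphB !rmorphM /= /d2 /d3; ring.
by rewrite mR mulr0 mulf_eq0 (negPf q10) (negPf q20).
Qed.

End NormalForms.

(** * Reduction of products of three linear forms to the normal forms *)

Section Classification.
Variable K : fieldType.
Hypothesis char0 : forall k, (k%:R == 0 :> K) = (k == 0)%N.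
Local Notation P := {mpoly K[3]}.
Local Notation X := ('X_0 : P).
Local Notation Y := ('X_1 : P).
Local Notation Z := ('X_2 : P).
Implicit Types (l Om : P) (t : 3.-tuple P).

Definition lin (a b c : K) : P := a *: X + b *: Y + c *: Z.

Lemma lin_homog a b c : lin a b c \is 1.-homog.
Proof. by apply: rpredD; [apply: rpredD|]; rewrite rpredZ ?homogX. Qed.

Lemma linE l : l \is 1.-homog -> l = lin l@_U_(0) l@_U_(1) l@_U_(2).
Proof. by move=> /linear_formE {1}->; rewrite sum_ord3. Qed.

Lemma X_lin : (X = lin 1 0 0) * (Y = lin 0 1 0) * (Z = lin 0 0 1).
Proof. by rewrite /lin !scale1r !scale0r !addr0 !add0r. Qed.

Lemma lin_comp a b c t :
  lin a b c \mPo t = a *: tnth t 0 + b *: tnth t 1 + c *: tnth t 2.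
Proof. by rewrite !comp_mpolyD !comp_mpolyZ !tnth_comp. Qed.

Lemma lin_comb a b c a0 a1 a2 b0 b1 b2 c0 c1 c2 :
  a *: lin a0 a1 a2 + b *: lin b0 b1 b2 + c *: lin c0 c1 c2 =
  lin (a * a0 + b * b0 + c * c0) (a * a1 + b * b1 + c * c1) (a * a2 + b * b2 + c * c2).
Proof. by rewrite /lin -!mul_mpolyC !(rmorphD, rmorphM) /=; ring. Qed.

Lemma mderiv_lin j a b c : mderiv j (lin a b c) =
  (a * (j == 0)%:R + b * (j == 1)%:R + c * (j == 2)%:R)%:MP.
Proof.
rewrite /lin !mderivD !mderivZ !mderivXU -!mul_mpolyC !(rmorphD, rmorphM) /=.
by rewrite !mpolyC_nat.
Qed.

Lemma jac_lin a0 a1 a2 b0 b1 b2 c0 c1 c2 :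
  jac (lin a0 a1 a2) (lin b0 b1 b2) (lin c0 c1 c2) =
  (a0 * (b1 * c2 - b2 * c1) - a1 * (b0 * c2 - b2 * c0) + a2 * (b0 * c1 - b1 * c0))%:MP.
Proof.
rewrite /jac /pbr /d1 /d2 /d3 !mderiv_lin /= !(mulr0, mulr1, addr0, add0r).
by rewrite !(rmorphD, rmorphN, rmorphM).
Qed.

Lemma linear_inverse (y : 3.-tuple P) : (forall i, tnth y i \is 1.-homog) ->
  jact y != 0 -> exists z : 3.-tuple P, [/\ forall i, tnth z i \is 1.-homog,
    forall i, tnth y i \mPo z = 'X_i & forall i, tnth z i \mPo y = 'X_i].
Proof.
move=> hy; have yE i : exists a b c, tnth y i = lin a b c.
  by do 3!eexists; apply: linE.
have [[a0 [a1 [a2 y0]]] [b0 [b1 [b2 y1]]] [c0 [c1 [c2 y2]]]] := And3 (yE 0) (yE 1) (yE 2).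
rewrite /jact y0 y1 y2 jac_lin mpolyC_eq0; set D := _ + _ => D0.
(* These are the rows of the adjugate matrix divided by the determinant [D]. *)
exists [tuple
  lin ((b1 * c2 - b2 * c1) / D) ((a2 * c1 - a1 * c2) / D) ((a1 * b2 - a2 * b1) / D);
  lin ((b2 * c0 - b0 * c2) / D) ((a0 * c2 - a2 * c0) / D) ((a2 * b0 - a0 * b2) / D);
  lin ((b0 * c1 - b1 * c0) / D) ((a1 * c0 - a0 * c1) / D) ((a0 * b1 - a1 * b0) / D)].
split; apply: ord3P; rewrite ?mk3_0 ?mk3_1 ?mk3_2 ?lin_homog //.
- by rewrite y0 lin_comp mk3_0 mk3_1 mk3_2 lin_comb X_lin; congr lin; rewrite /D; field.
- by rewrite y1 lin_comp mk3_0 mk3_1 mk3_2 lin_comb X_lin; congr lin; rewrite /D; field.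
- by rewrite y2 lin_comp mk3_0 mk3_1 mk3_2 lin_comb X_lin; congr lin; rewrite /D; field.
- by rewrite lin_comp y0 y1 y2 lin_comb X_lin; congr lin; rewrite /D; field.
- by rewrite lin_comp y0 y1 y2 lin_comb X_lin; congr lin; rewrite /D; field.
by rewrite lin_comp y0 y1 y2 lin_comb X_lin; congr lin; rewrite /D; field.
Qed.

Lemma core_coordinates Om t N l1 l2 l3 :
  l1 \is 1.-homog -> l2 \is 1.-homog -> l3 \is 1.-homog -> jac l1 l2 l3 != 0 ->
  core Om t N -> exists z t',
    [/\ l1 \mPo z = X, l2 \mPo z = Y, l3 \mPo z = Z & core (Om \mPo z) t' N].
Proof.
move=> h1 h2 h3 J0 h; pose y : 3.-tuple P := [tuple l1; l2; l3].
have hy i : tnth y i \is 1.-homog by elim/ord3P: i.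
have [z [hz yz zy]] := linear_inverse hy J0.
exists z, (conjt y z t); split; last exact: core_conj.
- exact: (yz 0).
- exact: (yz 1).
exact: (yz 2).
Qed.

Lemma core_square_split c l1 l2 l3 t N : c != 0 ->
  l1 \is 1.-homog -> l2 \is 1.-homog -> l3 \is 1.-homog -> jac l1 l2 l3 != 0 ->
  core (c *: (l1 * l1 * l2)) t N -> False.
Proof.
move=> c0 h1 h2 h3 J0 /(core_coordinates h1 h2 h3 J0)[z [t' [z1 z2 _]]].
by rewrite comp_mpolyZ !rmorphM /= z1 z2; apply: core_square.
Qed.

Lemma jac_lin_minors a0 a1 a2 b0 b1 b2 :
  (forall k, jac (lin a0 a1 a2) (lin b0 b1 b2) 'X_k = 0) ->
  [/\ a0 * b1 = a1 * b0, a0 * b2 = a2 * b0 & a1 * b2 = a2 * b1].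
Proof.
move=> J0; have zero (x y z : K) : z%:MP = 0 :> P -> z = x - y -> x = y.
  by move=> /eqP; rewrite mpolyC_eq0 => /eqP -> /esym/eqP; rewrite subr_eq0 => /eqP.
have := J0 0; have := J0 1; have := J0 2; rewrite !X_lin !jac_lin => E2 E1 E0.
split; [apply: (zero _ _ _ E2) | apply/esym; apply: (zero _ _ _ E1) |
  apply: (zero _ _ _ E0)]; by ring.
Qed.

Lemma minors_sym (a b : 'I_3 -> K) : a 0 * b 1 = a 1 * b 0 ->
  a 0 * b 2 = a 2 * b 0 -> a 1 * b 2 = a 2 * b 1 -> forall i j, a i * b j = a j * b i.
Proof. by move=> E01 E02 E12; do 2!apply: ord3P. Qed.

(** The Jacobians with the coordinates are, up to sign, the 2 by 2 minors of the coefficients; a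
    nonzero coefficient of [l1] fixes the ratio. *)
Lemma linear_parallel l1 l2 : l1 \is 1.-homog -> l1 != 0 -> l2 \is 1.-homog ->
  (forall k, jac l1 l2 'X_k = 0) -> exists c, l2 = c *: l1.
Proof.
move=> h1 l10 h2 J0; have [j lj] := linear_form_neq0 h1 l10.
have J0' k : jac (lin l1@_U_(0) l1@_U_(1) l1@_U_(2))
                 (lin l2@_U_(0) l2@_U_(1) l2@_U_(2)) 'X_k = 0 by rewrite -!linE.
have [E01 E02 E12] := jac_lin_minors J0'.
have E i : l1@_U_(j) * l2@_U_(i) = l2@_U_(j) * l1@_U_(i).
  rewrite [RHS]mulrC.
  exact: (@minors_sym (fun i => l1@_U_(i)) (fun i => l2@_U_(i)) E01 E02 E12).
exists (l2@_U_(j) / l1@_U_(j)); apply: (scalerI lj).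
rewrite scalerA mulrCA divff // mulr1 {1}(linear_formE h2) {2}(linear_formE h1).
by rewrite !scaler_sumr; apply: eq_bigr => i _; rewrite !scalerA E.
Qed.

(** Expand [l3] in the basis [l1], [l2], ['X_k]; its Jacobian with [l1] and [l2] reads off the last
    coefficient. *)
Lemma linear_dependent l1 l2 l3 k : l1 \is 1.-homog -> l2 \is 1.-homog ->
  l3 \is 1.-homog -> jac l1 l2 'X_k != 0 -> jac l1 l2 l3 = 0 ->
  exists al be, l3 = al *: l1 + be *: l2.
Proof.
move=> h1 h2 h3 J0 J3; pose y : 3.-tuple P := [tuple l1; l2; 'X_k].
have hy i : tnth y i \is 1.-homog by elim/ord3P: i; rewrite ?homogX.
have [z [hz yz zy]] := linear_inverse hy J0.
have h3z : l3 \mPo z \is 1.-homog by apply: comp_homog.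
have E : l3 = (l3 \mPo z)@_U_(0) *: l1 + (l3 \mPo z)@_U_(1) *: l2 +
    (l3 \mPo z)@_U_(2) *: 'X_k.
  by rewrite -{1}(comp_zy zy l3) [in LHS](linE h3z) lin_comp.
exists (l3 \mPo z)@_U_(0), (l3 \mPo z)@_U_(1); rewrite {1}E.
suff -> : (l3 \mPo z)@_U_(2) = 0 by rewrite scale0r addr0.
move: J3; rewrite {1}E => {E}.
move: (l3 \mPo z)@_U_(0) (l3 \mPo z)@_U_(1) (l3 \mPo z)@_U_(2) => al be ga /eqP J3.
apply/eqP; move: J3.
have -> : jac l1 l2 (al *: l1 + be *: l2 + ga *: 'X_k) = ga *: jac l1 l2 'X_k.
  have e w : jac l1 l2 w = jac w l1 l2 by rewrite [RHS]jacC.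
  by rewrite !e !jacD !jacZ /jac /pbr -!mul_mpolyC; ring.
by rewrite scaler_eq0 (negPf J0) orbF.
Qed.

(** The cases follow the rank of the three forms: rank 3 gives [xyz]; rank 2 gives three lines in a
    pencil, or a square if two forms are parallel; rank 1 gives a cube. *)
Lemma core_split_false c l1 l2 l3 t N : c != 0 ->
  l1 \is 1.-homog -> l1 != 0 -> l2 \is 1.-homog -> l2 != 0 ->
  l3 \is 1.-homog -> l3 != 0 -> core (c *: (l1 * l2 * l3)) t N -> False.
Proof.
move=> c0 h1 l10 h2 l20 h3 l30 h.
have [J3|J3] := eqVneq (jac l1 l2 l3) 0; last first.
  have [z [t' [z1 z2 z3]]] := core_coordinates h1 h2 h3 J3 h.
  by rewrite comp_mpolyZ !rmorphM /= z1 z2 z3; apply: core_xyz.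
have [/existsP[k Jk]|/existsPn J12] := boolP [exists k, jac l1 l2 'X_k != 0].
  have [al [be E]] := linear_dependent h1 h2 h3 Jk J3.
  have [al0|al0] := eqVneq al 0.
    have be0 : be != 0.
      by apply: contraNneq l30 => be0; rewrite E al0 be0 !scale0r addr0.
    have Jk' : jac l2 l1 'X_k != 0 by rewrite jac_swap oppr_eq0.
    apply: (@core_square_split (c * be) l2 l1 'X_k t N) => //; rewrite ?mulf_neq0 ?homogX //.
    suff -> : (c * be) *: (l2 * l2 * l1) = c *: (l1 * l2 * l3) by [].
    by rewrite E al0 scale0r add0r -!mul_mpolyC rmorphM /=; ring.
  have [be0|be0] := eqVneq be 0.
    apply: (@core_square_split (c * al) l1 l2 'X_k t N) => //; rewrite ?mulf_neq0 ?homogX //.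
    suff -> : (c * al) *: (l1 * l1 * l2) = c *: (l1 * l2 * l3) by [].
    by rewrite E be0 scale0r addr0 -!mul_mpolyC rmorphM /=; ring.
  have [z [t' [z1 z2 z3]]] := core_coordinates h1 h2 (homogX _ k) Jk h.
  rewrite comp_mpolyZ !rmorphM /= E comp_mpolyD !comp_mpolyZ z1 z2.
  exact: core_plane_generic.
have J12' k : jac l1 l2 'X_k = 0 by apply/eqP; have := J12 k; rewrite negbK.
have [g E2] := linear_parallel h1 l10 h2 J12'.
have g0 : g != 0 by apply: contraNneq l20 => g0; rewrite E2 g0 scale0r.
have [/existsP[k Jk]|/existsPn J13] := boolP [exists k, jac l1 l3 'X_k != 0].
  apply: (@core_square_split (c * g) l1 l3 'X_k t N) => //; rewrite ?mulf_neq0 ?homogX //.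
  suff -> : (c * g) *: (l1 * l1 * l3) = c *: (l1 * l2 * l3) by [].
  by rewrite E2 -!mul_mpolyC rmorphM /=; ring.
have J13' k : jac l1 l3 'X_k = 0 by apply/eqP; have := J13 k; rewrite negbK.
have [g' E3] := linear_parallel h1 l10 h3 J13'.
have g0' : g' != 0 by apply: contraNneq l30 => g0'; rewrite E3 g0' scale0r.
have [i [j Jij]] : exists i j, jac l1 'X_i 'X_j != 0.
  have [k lk] := linear_form_neq0 h1 l10; rewrite (linE h1).
  elim/ord3P: k lk => lk; [exists 1, 2 | exists 2, 0 | exists 0, 1];
    rewrite !X_lin jac_lin mpolyC_eq0; apply: contraNneq lk => <-; apply/eqP; by ring.
have [z [t' [z1 _ _]]] := core_coordinates h1 (homogX _ i) (homogX _ j) Jij h.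
have -> : (c *: (l1 * l2 * l3)) \mPo z = (c * g * g') *: 'X_0 ^+ 3.
  by rewrite E2 E3 comp_mpolyZ !rmorphM /= !comp_mpolyZ z1 -!mul_mpolyC !rmorphM /=; ring.
by apply: core_cubic; rewrite // !mulf_neq0.
Qed.

End Classification.

(** * From the isomorphism to triviality of the group *)

Section Invariants.
Variable K : fieldType.
Hypothesis char0 : forall k, (k%:R == 0 :> K) = (k == 0)%N.
Local Notation P := {mpoly K[3]}.
Variable Om : P.
Hypotheses (Om0 : Om != 0) (hOm : Om \is 3.-homog).

Lemma alg_hom_comp (phi : P -> P) a : is_alg_hom phi ->
  phi a = a \mPo [tuple phi 'X_i | i < 3].
Proof.
move=> [phiD phiZ phiM phi1]; elim/mpoly_ring_ind: a => [c|i|a b IHa IHb|a b IHa IHb].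
- by rewrite comp_mpolyC -[c%:MP]mulr1 mul_mpolyC phiZ phi1.
- by rewrite tnth_comp tnth_mktuple.
- by rewrite phiD IHa IHb comp_mpolyD.
by rewrite phiM IHa IHb rmorphM.
Qed.

Lemma homog_degP d (p : P) : homog_deg d p <-> p \is d.-homog.
Proof. by split=> [h|/dhomogP h]; [apply/dhomogP|]. Qed.

(** The given list only covers [G] and may contain other maps, so it is filtered classically.
    Passing to images of the coordinates gives decidable equality, needed to remove duplicates. *)
Lemma finite_list_of (G : (P -> P) -> Prop) (r : seq (P -> P)) :
  exists S : seq (3.-tuple P), uniq S /\
    forall s, s \in S <-> exists g, [/\ List.In g r, G g & s = [tuple g 'X_i | i < 3]].
Proof.
elim: r => [|g r [S [uS hS]]].
  by exists [::]; split=> // s; split=> // -[g []].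
have [Gg|nGg] := classic (G g).
  exists (undup ([tuple g 'X_i | i < 3] :: S)); split; first exact: undup_uniq.
  move=> s; rewrite mem_undup inE; split.
    case/orP => [/eqP ->|/hS[h [hr Gh ->]]]; first by exists g; split=> //; left.
    by exists h; split=> //; right.
  move=> [h [[<-|hr] Gh ->]]; first by rewrite eqxx.
  by apply/orP; right; apply/hS; exists h.
exists S; split=> // s; rewrite hS; split=> -[h [hr Gh ->]]; exists h; split=> //.
  by right.
by case: hr Gh => // <- /nGg.
Qed.

Section Group.
Variable t : 3.-tuple P.
Hypothesis t_inj : injective (comp_mpoly t).
Hypothesis t_graded : forall a d, exists b, b \mPo t = pihomog mdeg d (a \mPo t).
Hypothesis t_poisson : forall a b, pbr Om a b \mPo t = pbr Om (a \mPo t) (b \mPo t).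
Hypothesis t_fiber : forall v,
  (forall i, (tnth t i).@[v] = (tnth t i)@_0) -> forall i, v i = 0.
Hypothesis t_integral : forall u, exists F, [/\ over_image t F, F \is monic & F.[u] = 0].
Hypothesis t_split : exists (s : seq P) (b : P) (c : K),
  [/\ forall l, l \in s -> l \is 1.-homog /\ l != 0, c != 0 &
      jact t * b = c *: \prod_(l <- s) l].

Let p0 : 'I_3 -> K := fun i => (tnth t i)@_0.

Lemma jact_neq0 : jact t != 0.
Proof.
have [s [b [c [hs c0 e]]]] := t_split; have : jact t * b != 0.
  rewrite e scaler_eq0 negb_or c0 prodf_seq_neq0; apply/allP => l /hs[_ l0].
  exact: l0.
by apply: contraNneq => ->; rewrite mul0r.
Qed.

(** Starting from the coordinates, whose Jacobian is 1, each slot is replaced in turn after a cyclic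
    rotation. *)
Lemma homogeneous_triple : exists a1 a2 a3 e1 e2 e3,
  [/\ a1 \mPo t \is e1.-homog, a2 \mPo t \is e2.-homog, a3 \mPo t \is e3.-homog &
      (jac a1 a2 a3).@[p0] != 0].
Proof.
have nz : (jac 'X_0 'X_1 'X_2).@[p0] != 0 by rewrite jac_X meval1 oner_eq0.
have [a1 [e1 [h1 nz1]]] := select_component t_inj t_graded nz; rewrite jacC in nz1.
have [a2 [e2 [h2 nz2]]] := select_component t_inj t_graded nz1; rewrite jacC in nz2.
have [a3 [e3 [h3 nz3]]] := select_component t_inj t_graded nz2; rewrite jacC in nz3.
by exists a1, a2, a3, e1, e2, e3.
Qed.

Lemma jact_const : jact t \is 0.-homog.
Proof.
have [a1 [a2 [a3 [e1 [e2 [e3 [h1 h2 h3 nz]]]]]]] := homogeneous_triple.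
have [[|N] [_ _ _ _ hJ]] := jact_homog t_inj jact_neq0 h1 h2 h3 nz; first by [].
exfalso; have gradOm := poisson_hom_gradient t_poisson.
have J0 := jact_neq0; have compOm := comp_Om_eq char0 hOm hJ gradOm.
have OmE : Om \mPo t - ((Om \mPo t)@_0)%:MP =
    (3%:R / (N.+1 + 3)%:R) *: (jact t * Om).
  have n0 : ((N.+1 + 3)%:R : K) != 0 by rewrite char0.
  by apply: (scalerI n0); rewrite compOm scalerA mulrCA divff // mulr1.
(* In the nonsingular case [B(t)] has degree [N + 4]; completed by two homogeneous entries of
   positive degree it would give [J] degree at least [N + 3], but that degree is [N + 1]. *)
have [/existsP[j nzj]|/existsPn grad0] := boolP [exists j, (mderiv j Om).@[p0] != 0].
  pose B := Om - ((Om \mPo t)@_0)%:MP.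
  have hB : B \mPo t \is (N.+1 + 3).-homog.
    rewrite comp_mpolyB comp_mpolyC OmE rpredZ //; exact: dhomogM.
  (* The two coordinates other than the [j]-th, in cyclic order, have Jacobian with [Om] equal to
     its [j]-th derivative. *)
  have [x [y nzB]] : exists x y, (jac x y B).@[p0] != 0.
    have e k k' : jac 'X_k 'X_k' B = jac 'X_k 'X_k' Om.
      by rewrite -[LHS]jacC -[RHS]jacC jacD jacN jac_const subr0.
    elim/ord3P: j nzj => nzj; [exists 'X_1, 'X_2 | exists 'X_2, 'X_0 | exists 'X_0, 'X_1];
      rewrite e; congr (_ != 0): nzj; congr (_.@[_]);
      by rewrite /jac /pbr /d1 /d2 /d3 !mderivXU /=; ring.
  have [x' [f1 [g1 nz1]]] := select_component t_inj t_graded nzB; rewrite jacC in nz1.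
  have [y' [f2 [g2 nz2]]] := select_component t_inj t_graded nz1; rewrite jacC in nz2.
  have [N' [sz _ f10 f20 hJ']] := jact_homog t_inj J0 hB g1 g2 nz2.
  have := dhomog_uniq J0 hJ hJ'; move: sz f10 f20; clear; lia.
(* By Euler's formula a singular point of [Om] is a zero of [Om], so the constant [c] vanishes. *)
have Omp : Om.@[p0] = 0.
  have := congr1 (meval p0) (euler_homog hOm); rewrite mevalZ rmorph_sum /= big1.
    by move=> /esym/eqP; rewrite mulf_eq0 char0 => /eqP.
  by move=> i _; have := grad0 i; rewrite negbK mevalM => /eqP ->; rewrite mulr0.
have c00 : (Om \mPo t)@_0 = 0.
  rewrite -meval0E comp_mpoly_meval -[RHS]Omp; apply: meval_eq => i; exact: meval0E.
have [c c0 cube] := jact_cube char0 Om0 hOm J0 hJ gradOm.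
have hcore : core Om t N.+1.
  split=> //; last by exists c.
  by move: compOm; rewrite c00 mpolyC0 subr0.
have [s [b [e [hs e0 eJ]]]] := t_split.
(* Cubing the relation for [J] turns [J ^ 3] into a multiple of [Om ^ N.+1], so [Om] divides three
   copies of the product of linear forms. *)
have : Om * (c *: (Om ^+ N * b ^+ 3)) = e ^+ 3 *: \prod_(l <- flatten (nseq 3 s)) l.
  by rewrite prod_flatten_nseq -exprZn -eJ exprMn cube -!mul_mpolyC [Om ^+ N.+1]exprS; ring.
case/dvd_prod_linear => [l /flatten_nseq_sub/hs //||k [s' [k0 sub OmS]]].
  by rewrite expf_neq0.
have hs' l : l \in s' -> l \is 1.-homog /\ l != 0 by move=> /sub/flatten_nseq_sub/hs.
have : size s' = 3.
  apply: (homog_uniq Om0) hOm; rewrite OmS rpredZ // prod_linear_homog // => l /hs'[].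
  by [].
case: s' OmS hs' {sub} => [//|l1 [//|l2 [//|l3 [|//]]]] OmS hs' _.
have [[h1' z1] [h2' z2] [h3' z3]] : [/\ l1 \is 1.-homog /\ l1 != 0,
    l2 \is 1.-homog /\ l2 != 0 & l3 \is 1.-homog /\ l3 != 0].
  by split; apply: hs'; rewrite !inE eqxx ?orbT.
apply: (@core_split_false _ char0 k l1 l2 l3 t N.+1) => //.
by rewrite -mulrA; rewrite OmS !big_cons big_nil mulr1 in hcore.
Qed.

(** With [J] constant the three positive degrees sum to 3, so the image contains three independent
    linear forms, and inverting them linearly yields the coordinates. *)
Lemma coordinates_in_image i : exists b, 'X_i = b \mPo t.
Proof.
have [a1 [a2 [a3 [e1 [e2 [e3 [h1 h2 h3 nz]]]]]]] := homogeneous_triple.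
have [N [sz l1 l2 l3 hJ]] := jact_homog t_inj jact_neq0 h1 h2 h3 nz.
have N0 := dhomog_uniq jact_neq0 hJ jact_const.
have [E1 E2 E3] : [/\ e1 = 1, e2 = 1 & e3 = 1]%N.
  by split; move: sz l1 l2 l3 N0; clear; lia.
subst e1 e2 e3; pose y : 3.-tuple P := [tuple a1 \mPo t; a2 \mPo t; a3 \mPo t].
have hy j : tnth y j \is 1.-homog by elim/ord3P: j.
have Jy : jact y != 0.
  rewrite /jact mk3_0 mk3_1 mk3_2 jac_comp mulf_neq0 ?jact_neq0 //.
  apply: contraNneq nz => e; have -> : jac a1 a2 a3 = 0.
    by apply: t_inj; rewrite e comp_mpoly0.
  by rewrite meval0.
have [z [_ _ zy]] := linear_inverse hy Jy.
exists (tnth z i \mPo [tuple a1; a2; a3]); rewrite -zy comp_mpolyA.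
apply: (congr1 (fun w => comp_mpoly w (tnth z i))); apply: eq_from_tnth => j.
by rewrite tnth_mktuple; elim/ord3P: j.
Qed.

End Group.

Lemma trivial_of_iso (G : (P -> P) -> Prop) :
  finite_subgroup_PAut Om G -> poisson_iso_to_invariants Om G -> trivial_group G.
Proof.
move=> [Gaut Gid Gmul _ [r Gr]] [psi [psi_hom psi_inj psi_inv psi_sur psi_br]].
have [S [S_uniq hS]] := finite_list_of G r.
have {hS} SP s : s \in S <-> exists2 g, G g & s = [tuple g 'X_i | i < 3].
  by rewrite hS; split=> [[g [_ Gg ->]]|[g Gg ->]]; exists g => //; split=> //; apply: Gr.
have Ghom g : G g -> is_alg_hom g by move=> /Gaut[].
pose t := [tuple psi 'X_i | i < 3].
have psiE a : psi a = a \mPo t by apply: alg_hom_comp.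
have t_inj : injective (comp_mpoly t).
  by move=> a b; rewrite -!psiE => /psi_inj.
have S_id : idt K \in S by apply/SP; exists id.
(* Substitution reverses the order: the tuples of [h] and [k] multiply to the tuple of [k \o h]. *)
have S_mul s g : s \in S -> g \in S -> mulT s g \in S.
  move=> /SP[h Gh ->] /SP[k Gk ->]; apply/SP; exists (k \o h); first exact: Gmul.
  by apply: eq_from_tnth => i; rewrite !tnth_mktuple /= -alg_hom_comp //; apply: Ghom.
have S_inj g : g \in S -> injective (comp_mpoly g).
  move=> /SP[h Gh ->] a b; rewrite -!alg_hom_comp; try exact: Ghom.
  by have [/bij_inj] := Gaut _ Gh => inj _ _ _ /inj.
have S_lin g i : g \in S -> tnth g i \is 1.-homog.
  move=> /SP[h Gh ->]; rewrite tnth_mktuple; have [_ _ _ /(_ 1%N)[hom _]] := Gaut _ Gh.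
  by apply/homog_degP/hom/homog_degP/homogX.
have invP a : (forall g, g \in S -> a \mPo g = a) <-> exists b, a = b \mPo t.
  split=> [inv|[b ->] g /SP[h Gh ->]].
    have [|b <-] := psi_sur a; last by exists b; rewrite psiE.
    move=> g Gg; rewrite (alg_hom_comp _ (Ghom _ Gg)); apply: inv.
    by apply/SP; exists g.
  by rewrite -alg_hom_comp; [rewrite -psiE; apply: psi_inv | apply: Ghom].
have t_graded := invariants_graded S_lin invP.
have t_fiber := fiber_origin S_uniq S_id S_mul S_inj S_lin invP.
have t_split := jact_dvd_linear char0 S_uniq S_id S_mul S_inj S_lin invP.
have t_poisson a b : pbr Om a b \mPo t = pbr Om (a \mPo t) (b \mPo t).
  by rewrite -!psiE psi_br.
have t_integral u : exists F, [/\ over_image t F, F \is monic & F.[u] = 0].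
  exists (orbit_poly S u); split; last exact: orbit_poly_root.
    exact: orbit_poly_over_image.
  exact: monic_prod_XsubC.
move=> g Gg a; rewrite (alg_hom_comp _ (Ghom _ Gg)) -[RHS]comp_mpoly_id.
apply: (congr1 (fun w => comp_mpoly w a)); apply: eq_from_tnth => i.
rewrite !tnth_mktuple.
have /invP/(_ [tuple g 'X_j | j < 3]) :=
  coordinates_in_image t_inj t_graded t_poisson t_fiber t_integral t_split i.
by rewrite tnth_comp tnth_mktuple; apply; apply/SP; exists g.
Qed.

End Invariants.

Theorem theorem3p1 (K : closedFieldType) (hK : [pchar K] =i pred0)
  (Om : {mpoly K[3]}) (hOm0 : Om != 0) (hOm3 : homog_deg 3 Om)
  (G : ({mpoly K[3]} -> {mpoly K[3]}) -> Prop)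
  (hG : finite_subgroup_PAut Om G) :
  poisson_iso_to_invariants Om G <-> trivial_group G.
Proof.
have char0 : forall k, (k%:R == 0 :> K) = (k == 0)%N by apply/pcharf0P.
split; first by apply: trivial_of_iso => //; apply/homog_degP.
move=> trivG; exists id; split=> //; last by move=> b _; exists b.
by move=> a g Gg; apply: trivG.
Qed.
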